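(* Let $d\ge2$, $\beta>1$ and $\theta>0$. Let $\{\Xi_\sigma\}_{\sigma>0}$ and $\Xi$ be point processes on $\mathbb{R}^d$ (random locally finite configurations, each almost surely containing at least one point) such that $\Xi_\sigma\to\Xi$ in distribution as $\sigma\to\infty$ with respect to the vague topology on locally finite configurations. For a configuration $\mathcal P$ and $R>0$ set $$\Sigma^\beta_R(\mathcal P):=\sum_{\zeta\in\mathcal P:\ |\zeta|>R}\frac{1}{|\zeta|^{d\beta}},$$ and assume $\Sigma_R^\beta\to0$ in probability as $R\to\infty$ uniformly over the family $\mathcal F=\{\Xi\}\cup\{\Xi_\sigma\}_{\sigma>0}$, i.e. for every $\varepsilon>0$, $\sup_{\mathcal P\in\mathcal F}\mathbb{P}\big(\Sigma_R^\beta(\mathcal P)>\varepsilon\big)\to0$ as $R\to\infty$. Then $p_c(\theta,\Xi_\sigma)\to p_c(\theta,\Xi)$ as $\sigma\to\infty$.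
   Context: For a point process $\mathcal P=\{X_i\}$ on $\mathbb{R}^d$, let $X_B$ denote a point of $\mathcal P$ of least Euclidean modulus, and define $$p_c(\theta,\mathcal P):=\mathbb{E}\Big[\prod_{X_j\in\mathcal P,\ j\neq B}\Big(1+\theta\Big|\frac{X_B}{X_j}\Big|^{d\beta}\Big)^{-1}\Big]$$ (the coverage probability at threshold $\theta$ with path loss $r\mapsto r^{-d\beta}$ and Rayleigh fading; the value of the product does not depend on the choice of $B$ in case of ties). *)

(* Defs.v *)
From HB Require Import structures.
From mathcomp Require Import all_boot all_order all_algebra.
From mathcomp Require Import all_classical all_reals all_analysis.
Set Implicit Arguments. Unset Strict Implicit. Unset Printing Implicit Defensive.
Import Order.TTheory GRing.Theory Num.Theory.
Import numFieldNormedType.Exports.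
Local Open Scope classical_set_scope.
Local Open Scope ring_scope.

Section PP.
Variables (R : realType) (d : nat).

Definition eucl (x : 'rV[R]_d) : R := Num.sqrt (\sum_(i < d) x ord0 i ^+ 2).

(* a (simple) configuration is a set of points; locally finite: every ball
   contains finitely many points *)
Definition locally_finite (mu : set 'rV[R]_d) : Prop :=
  forall r : R, finite_set (mu `&` [set x | eucl x <= r]).

Definition Cc (g : 'rV[R]_d -> R) : Prop :=
  continuous g /\ compact (closure (g @^-1` [set~ 0])).

(* linear statistic  sum_{x in mu} g x  (finite for Cc g and locally finite mu) *)
Definition linstat (g : 'rV[R]_d -> R) (mu : set 'rV[R]_d) : R :=
  (\sum_(x \in mu) g x)%R.

(* continuity of f at mu for the vague topology on locally finite
   configurations: the vague topology is the initial topology of the maps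
   mu |-> linstat g mu, g in C_c; this is the neighbourhood-basis unfolding *)
Definition vague_continuous_at (f : set 'rV[R]_d -> R) (mu : set 'rV[R]_d) :=
  forall eps : R, 0 < eps ->
  exists (k : nat) (gs : 'I_k -> 'rV[R]_d -> R) (delta : R),
    (forall i, Cc (gs i)) /\ 0 < delta /\
    forall nu, locally_finite nu ->
      (forall i, `|linstat (gs i) nu - linstat (gs i) mu| < delta) ->
      `|f nu - f mu| < eps.

Definition vague_bounded_continuous (f : set 'rV[R]_d -> R) : Prop :=
  (exists M : R, forall mu, `|f mu| <= M) /\
  (forall mu, locally_finite mu -> vague_continuous_at f mu).

(* point process on a probability space: a random locally finite configuration,
   measurable w.r.t. the sigma-algebra generated by the linear statistics
   (= Borel sigma-algebra of the vague topology) *)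
Definition point_process (dO : measure_display) (O : measurableType dO)
  (X : O -> set 'rV[R]_d) : Prop :=
  (forall w, locally_finite (X w)) /\
  (forall g, Cc g -> measurable_fun setT (fun w => linstat g (X w))).

Definition tailsum (beta r : R) (mu : set 'rV[R]_d) : \bar R :=
  \esum_(x in [set x | mu x /\ (r < eucl x)%R]) ((eucl x `^ (d%:R * beta))^-1)%:E.

Definition least_point (mu : set 'rV[R]_d) : 'rV[R]_d :=
  xget 0 [set b | mu b /\ forall y, mu y -> eucl b <= eucl y].

Definition cov_factor (theta beta : R) (b x : 'rV[R]_d) : R :=
  (1 + theta * (eucl b / eucl x) `^ (d%:R * beta))^-1.

(* the infinite product prod_{x in mu, x <> b} of factors in (0,1],
   i.e. the infimum of the finite partial products *)
Definition cov_product (theta beta : R) (mu : set 'rV[R]_d) : R :=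
  let b := least_point mu in
  inf [set p | exists F : set 'rV[R]_d,
         [/\ finite_set F, F `<=` mu `\ b &
             p = (\big[*%R/1%R]_(x \in F) cov_factor theta beta b x)%R]].

Definition p_c (dO : measure_display) (O : measurableType dO)
  (P : probability O R) (theta beta : R) (X : O -> set 'rV[R]_d) : \bar R :=
  (\int[P]_w (cov_product theta beta (X w))%:E)%E.

End PP.

(* Main.v *)
Require Import Defs.
From HB Require Import structures.
From mathcomp Require Import all_boot all_order all_algebra finmap.
From mathcomp Require Import all_classical all_reals all_analysis.
From mathcomp Require Import measurable_realfun.
From mathcomp Require Import ring lra.
Set Implicit Arguments. Unset Strict Implicit. Unset Printing Implicit Defensive.
Import Order.TTheory GRing.Theory Num.Theory.
Import numFieldNormedType.Exports.
Local Open Scope classical_set_scope.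
Local Open Scope ring_scope.

(** With [tau x = |x|^(d beta)] and [rho] the least value of [tau] on the
    configuration, the coverage product is
    [prod_(x <> B) (1 + theta rho / tau x)^-1].  Including the factor of the
    nearest point, which is [(1 + theta)^-1], turns it into
    [c(r) exp (- sum_x ln (1 + theta r / tau x))] at [r = rho].  Cutting [tau]
    off from below at [dl] and the sum off at [tau x <= M] makes the exponent a
    linear statistic for each fixed [r], with a compensating prefactor
    [c(r) = 1 + theta min(1, r / dl)] that remains exact as long as no second
    point satisfies [tau x < dl].  The random radius [rho] is removed by
    averaging over a grid of deterministic radii [i h], with weights that are
    increments of clamped linear statistics approximating
    [rho <= i h].  The resulting functional is a continuous function of finitely
    many linear statistics, hence vaguely continuous.

    Its distance to the coverage product is small unless there is no point with
    [tau x <= t], there are two points with [tau x < dl], there are many points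
    with [tau x <= M], or the tail sum is large.  The first three events are
    dominated by vaguely continuous functionals whose expectation under the limit
    process tends to [0] by dominated convergence, so they are also unlikely for
    [Xis s] with [s] large; the last one is controlled by the uniform tail
    hypothesis. *)

(** * The modulus [tau] and linear statistics *)

Lemma continuous_powR_norm (R : realType) (a : R) : 0 < a ->
  continuous (fun t : R => `|t| `^ a).
Proof.
move=> a0 t; have [->|t0] := eqVneq t 0.
  apply/cvgrPdist_lt => e e0.
  have ea : 0 < e `^ (a^-1) by exact: powR_gt0.
  have H : \forall s \near (0 : R), `|s| < e `^ a^-1.
    have /cvgrPdist_lt/(_ _ ea) : (s : R) @[s --> 0] --> (0 : R) by exact: cvg_id.
    by apply: filterS => s; rewrite sub0r normrN.
  apply: filterS H => s sa.
  rewrite normr0 powR0 ?gt_eqF// sub0r normrN ger0_norm ?powR_ge0//.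
  have -> : e = (e `^ (a^-1)) `^ a by rewrite -powRrM mulVf ?gt_eqF// powRr1// ltW.
  by apply: (gt0_ltr_powR a0); rewrite ?nnegrE ?normr_ge0 ?powR_ge0.
have nt : 0 < `|t| by rewrite normr_gt0.
have H : (fun s : R => expR (a * ln `|s|)) @ t --> expR (a * ln `|t|).
  apply: (@continuous_cvg _ _ _ _ _ _ expR); first exact: continuous_expR.
  apply: cvgMr.
  apply: (@continuous_cvg _ _ _ _ _ _ (@ln R)); first exact: continuous_ln.
  exact: norm_continuous.
have E (s : R) : s != 0 -> `|s| `^ a = expR (a * ln `|s|).
  by move=> s0; rewrite /powR gt_eqF ?normr_gt0//=.
rewrite /continuous_at E//; apply: cvg_trans H; apply: near_eq_cvg.
have H0 : \forall s \near t, s != 0.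
  by apply: open_nbhs_nbhs; split => //; exact: open_neq.
by apply: filterS H0 => s s0; rewrite /= E.
Qed.

Section Tau.
Variables (R : realType) (d : nat).
Implicit Types (x : 'rV[R]_d) (mu : set 'rV[R]_d).

Lemma eucl_ge0 x : 0 <= eucl x.
Proof. exact: sqrtr_ge0. Qed.

Lemma continuous_eucl : continuous (@eucl R d).
Proof.
rewrite (_ : @eucl R d = @Num.sqrt R \o (fun x => \sum_(i < d) x ord0 i ^+ 2))//.
move=> x; apply: continuous_comp; last exact: sqrt_continuous.
apply: (@cvg_big R _ +%R 0 xpredT _ _ (nbhs x) _ (fun i (y : 'rV[R]_d) => y ord0 i ^+ 2)
  (fun i => x ord0 i ^+ 2)) => [|i _]; first exact: add_continuous.
apply: (@continuous_comp _ _ _ (fun x : 'rV[R]_d => x ord0 i) (fun t : R => t ^+ 2)).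
  exact: coord_continuous.
exact: exprn_continuous.
Qed.

Lemma coord_le_eucl x i : `|x ord0 i| <= eucl x.
Proof.
have s0 : 0 <= \sum_(i < d) x ord0 i ^+ 2 by apply: sumr_ge0 => j _; exact: sqr_ge0.
rewrite /eucl -[leLHS]sqrtr_sqr ler_sqrt//.
by rewrite (bigD1 i)//= lerDl sumr_ge0// => j _; rewrite sqr_ge0.
Qed.

Lemma compact_eucl_ball (r : R) : compact [set x : 'rV[R]_d | eucl x <= r].
Proof.
apply: bounded_closed_compact.
- exists r; split; first exact: num_real.
  move=> M rM x /= xr; rewrite /Num.norm/= mx_normrE.
  apply: (big_ind (fun y => y <= M)) => [|a b aM bM|[i j] _].
  + by rewrite (le_trans _ (ltW rM))// (le_trans (eucl_ge0 x)).
  + by rewrite ge_max aM.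
  + by rewrite (ord1 i)/= (le_trans (coord_le_eucl x j))// (le_trans xr)// ltW.
- apply: (@closed_comp _ _ (@eucl R d) [set t | t <= r]) => [x _|]; first exact: continuous_eucl.
  exact: closed_le.
Qed.

Variable a : R.
Hypothesis a0 : 0 < a.
Definition tau x : R := eucl x `^ a.

Lemma tau_ge0 x : 0 <= tau x. Proof. exact: powR_ge0. Qed.

Lemma continuous_tau : continuous tau.
Proof.
rewrite (_ : tau = (fun t : R => `|t| `^ a) \o @eucl R d); last first.
  by apply/funext => x; rewrite /= ger0_norm ?eucl_ge0.
by move=> x; apply: continuous_comp; [exact: continuous_eucl|exact: continuous_powR_norm].
Qed.

Lemma tau_gt r x : 0 <= r -> (r `^ a < tau x) = (r < eucl x).
Proof.
move=> r0; apply/idP/idP; last by apply: gt0_ltr_powR; rewrite // ?nnegrE ?eucl_ge0.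
by apply: contraTT; rewrite -!leNgt => xr; apply: ge0_ler_powR; rewrite // ?nnegrE ?eucl_ge0// ltW.
Qed.

Lemma eucl_le_tau x M : tau x <= M -> eucl x <= M `^ a^-1.
Proof.
move=> xM; have -> : eucl x = tau x `^ a^-1.
  by rewrite -powRrM mulfV ?gt_eqF// powRr1// eucl_ge0.
have M0 := le_trans (tau_ge0 x) xM.
by apply: ge0_ler_powR; rewrite // ?nnegrE ?tau_ge0// invr_ge0 ltW.
Qed.

Lemma tau_mono x y : (tau x <= tau y) = (eucl x <= eucl y).
Proof. by rewrite leNgt tau_gt ?eucl_ge0// -leNgt. Qed.

Lemma finite_tau_ball mu M : locally_finite mu -> finite_set (mu `&` [set x | tau x <= M]).
Proof.
move=> /(_ (M `^ a^-1)); apply: sub_finite_set => x [mx /= xM]; split => //=.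
exact: eucl_le_tau.
Qed.

(** The support lies in a closed Euclidean ball, which is compact. All test functions of the proof
    arise this way, as radial functions of [tau]. *)
Lemma Cc_tau (G : R -> R) M : continuous G -> (forall t, M <= t -> G t = 0) ->
  Cc (G \o tau).
Proof.
move=> cG G0; split.
  by move=> x; apply: continuous_comp; [exact: continuous_tau|exact: cG].
apply: (subclosed_compact _ (@compact_eucl_ball (M `^ a^-1))).
  exact: closed_closure.
have cl : closed [set x : 'rV[R]_d | eucl x <= M `^ a^-1].
  apply: (@closed_comp _ _ (@eucl R d) [set t | t <= M `^ a^-1]) => [x _|]; first exact: continuous_eucl.
  exact: closed_le.
rewrite [X in _ `<=` X](closure_id _).1//; apply: closureS => x /= Gx.
apply: eucl_le_tau; rewrite leNgt; apply/negP => Mx; apply: Gx; apply: G0; exact: ltW.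
Qed.

End Tau.

(** * Linear statistics as finite sums *)

Section Linstat.
Variables (R : realType) (d : nat).
Implicit Types (x : 'rV[R]_d) (mu : set 'rV[R]_d) (D : {fset 'rV[R]_d}).
Local Open Scope fset_scope.
Local Open Scope ring_scope.

Lemma linstatE g mu D : (forall x, x \in D -> mu x) ->
  (forall x, mu x -> x \notin D -> g x = 0) -> linstat g mu = \sum_(x <- D) g x.
Proof.
move=> Dmu D0; rewrite /linstat (fsbigE D)//.
- rewrite big_seq_cond [RHS]big_seq; apply: eq_bigl => x.
  by case xD: (x \in D) => //=; apply/mem_set/Dmu.
Qed.

Definition tau_trace (a M : R) mu : {fset 'rV[R]_d} :=
  fset_set (mu `&` [set x | tau a x <= M]).

Lemma tau_traceP a M mu : 0 < a -> locally_finite mu ->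
  forall x, (x \in tau_trace a M mu) <-> mu x /\ tau a x <= M.
Proof.
move=> a0 lf x; rewrite /tau_trace in_fset_set; last exact: finite_tau_ball.
by rewrite inE.
Qed.

(** The sum in [linstat] takes a default value on infinite supports. Vanishing of [G] beyond [M] and
    local finiteness of [mu] exclude that case. *)
Lemma linstat_tau a M (G : R -> R) mu : 0 < a -> locally_finite mu ->
  (forall t, M <= t -> G t = 0) ->
  linstat (G \o tau a) mu = \sum_(x <- tau_trace a M mu) G (tau a x).
Proof.
move=> a0 lf G0; apply: linstatE => [x /(tau_traceP M a0 lf)[]//|x mx /negP xD].
apply: G0; rewrite leNgt; apply/negP => xM; apply: xD.
by apply/(tau_traceP M a0 lf); split => //; exact: ltW.
Qed.

Lemma linstat_ge0 g mu : (forall x, 0 <= g x) -> 0 <= linstat g mu.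
Proof. by move=> g0; apply: fsumr_ge0. Qed.

End Linstat.

(** * Lipschitz bounds, cutoffs and the truncated kernel *)

Section RealFunctions.
Variable R : realType.
Implicit Types (a b r s t th dl lo hi : R).

Lemma ln1D_lipschitz a b : 0 <= a -> 0 <= b -> `|ln (1 + a) - ln (1 + b)| <= `|a - b|.
Proof.
wlog ab : a b / b <= a.
  move=> H a0 b0; have [ba|/ltW ab] := leP b a; first exact: H.
  by have := H _ _ ab b0 a0; rewrite distrC (distrC b).
move=> a0 b0; have b1 : 0 < 1 + b by lra.
have q0 : 0 <= (a - b) / (1 + b) by rewrite divr_ge0 ?subr_ge0// ltW.
have -> : 1 + a = (1 + b) * (1 + (a - b) / (1 + b)) by field; rewrite gt_eqF.
rewrite lnM ?posrE//; last by lra.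
rewrite addrAC subrr add0r ger0_norm; last by apply: ln_ge0; lra.
rewrite ger0_norm ?subr_ge0//; apply: le_trans (le_ln1Dx _) _; first by lra.
by rewrite ler_pdivrMr// ler_peMr ?subr_ge0//; lra.
Qed.

Lemma expRN_lipschitz a b : 0 <= a -> 0 <= b -> `|expR (- a) - expR (- b)| <= `|a - b|.
Proof.
wlog ab : a b / a <= b.
  move=> H a0 b0; have [ab|/ltW ba] := leP a b; first exact: H.
  by have := H _ _ ba b0 a0; rewrite distrC (distrC b).
move=> a0 b0.
have -> : expR (- b) = expR (- a) * expR (- (b - a)) by rewrite -expRD; congr expR; ring.
rewrite -{1}[expR (- a)]mulr1 -mulrBr normrM ger0_norm ?expR_ge0//.
have e1 : expR (- a) <= 1 by rewrite -expR0 ler_expR oppr_le0.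
have e2 : expR (- (b - a)) <= 1 by rewrite -expR0 ler_expR oppr_le0 subr_ge0.
have e3 := expR_ge1Dx (- (b - a)).
rewrite (@ger0_norm _ (1 - _)) ?subr_ge0// distrC ger0_norm ?subr_ge0//.
apply: le_trans (_ : 1 * (1 - expR (- (b - a))) <= _); last by lra.
by apply: ler_wpM2r => //; lra.
Qed.

Definition clamp t : R := Num.min 1 (Num.max 0 t).

Lemma clamp_ge0 t : 0 <= clamp t.
Proof. by rewrite /clamp le_min ler01 le_max lexx. Qed.

Lemma clamp_le1 t : clamp t <= 1.
Proof. by rewrite /clamp ge_min lexx. Qed.

Lemma clamp1 t : 1 <= t -> clamp t = 1.
Proof. by move=> t1; rewrite /clamp min_l// le_max t1 orbT. Qed.

Lemma clamp0 t : t <= 0 -> clamp t = 0.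
Proof. by move=> t0; rewrite /clamp max_l// min_r. Qed.

Lemma clamp_le s t : s <= t -> clamp s <= clamp t.
Proof.
move=> st; rewrite /clamp le_min !ge_min lexx/=; apply/orP; right.
by rewrite ge_max !le_max lexx/= st orbT.
Qed.

Lemma continuous_clamp : continuous clamp.
Proof.
move=> t; apply: (@continuous_min R R (cst 1) (cst 0 \max id)); first exact: cvg_cst.
by apply: (@continuous_max R R (cst 0) id); [exact: cvg_cst|exact: cvg_id].
Qed.

(** For [lo < hi] this is the piecewise linear cutoff, [1] up to [lo] and [0] from [hi] on; its
    linear statistic is a continuous substitute for the number of points with [tau] at most [lo]. *)
Definition bump lo hi t := clamp ((hi - t) / (hi - lo)).

Lemma bump_ge0 lo hi t : 0 <= bump lo hi t. Proof. exact: clamp_ge0. Qed.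

Lemma bump_le1 lo hi t : bump lo hi t <= 1. Proof. exact: clamp_le1. Qed.

Lemma bump1 lo hi t : lo < hi -> t <= lo -> bump lo hi t = 1.
Proof. by move=> lh tl; apply: clamp1; rewrite ler_pdivlMr ?subr_gt0// mul1r; lra. Qed.

Lemma bump0 lo hi t : lo < hi -> hi <= t -> bump lo hi t = 0.
Proof.
by move=> lh ht; apply: clamp0; rewrite pmulr_lle0 ?invr_gt0 ?subr_gt0// subr_le0.
Qed.

Lemma continuous_bump lo hi : continuous (bump lo hi).
Proof.
move=> t; apply: (@continuous_comp _ _ _ (fun t => (hi - t) / (hi - lo)) clamp).
  by apply: cvgMl; apply: cvgB; [exact: cvg_cst|exact: cvg_id].
exact: continuous_clamp.
Qed.

(** Minus the logarithm of a coverage factor, with [t] cut off from below at [dl] to remove the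
    singularity at [t = 0]. *)
Definition kern th dl r t := ln (1 + th * (r / Num.max t dl)).

Section Kern.
Variables (th dl : R).
Hypotheses (th0 : 0 <= th) (dl0 : 0 < dl).

Let max_gt0 t : 0 < Num.max t dl. Proof. by rewrite lt_max dl0 orbT. Qed.

Let arg_ge0 r t : 0 <= r -> 0 <= th * (r / Num.max t dl).
Proof. by move=> r0; rewrite mulr_ge0// divr_ge0// ltW. Qed.

Lemma kern_ge0 r t : 0 <= r -> 0 <= kern th dl r t.
Proof. by move=> r0; apply: ln_ge0; rewrite lerDl arg_ge0. Qed.

(** The map [ln (1 + u)] is 1-Lipschitz for [u >= 0], and the cutoff keeps the denominator above
    [dl]; hence a constant uniform in [t]. *)
Lemma kern_lipschitz r s t : 0 <= r -> 0 <= s ->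
  `|kern th dl r t - kern th dl s t| <= th / dl * `|r - s|.
Proof.
move=> r0 s0; apply: le_trans (ln1D_lipschitz _ _) _; rewrite ?arg_ge0//.
rewrite -mulrBr -mulrBl !normrM (ger0_norm th0) normfV (gtr0_norm (max_gt0 t)).
rewrite -mulrA ler_wpM2l// mulrC ler_wpM2r// lef_pV2 ?posrE//.
by rewrite le_max lexx orbT.
Qed.

Lemma continuous_kern r : 0 <= r -> continuous (kern th dl r).
Proof.
move=> r0 t; apply: (@continuous_comp _ _ _ (fun t => 1 + th * (r / Num.max t dl)) (@ln R)).
  apply: cvgD; first exact: cvg_cst.
  apply: cvgMr; apply: cvgMr; apply: cvgV; first by rewrite gt_eqF.
  by apply: (@continuous_max R R id (cst dl)); [exact: cvg_id|exact: cvg_cst].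
by apply: continuous_ln; have := arg_ge0 t r0; lra.
Qed.

End Kern.
End RealFunctions.

(** * The coverage product at a fixed radius *)

Lemma ler_sum_fset (R : numDomainType) (T : choiceType) (G D : {fset T}) (f : T -> R) :
  (forall x, x \in G -> 0 <= f x) -> (forall x, x \in D -> 0 <= f x) ->
  (forall x, x \in G -> x \notin D -> f x = 0) ->
  \sum_(x <- G) f x <= \sum_(x <- D) f x.
Proof.
move=> fG fD f0.
have -> : \sum_(x <- G) f x = \sum_(x <- D | x \in G) f x.
  rewrite (bigID (mem D))/= [X in _ + X]big_seq_cond [X in _ + X]big1 ?addr0.
    by rewrite [LHS]big_fset_condE [RHS]big_fset_condE; apply: eq_fbigl => x; rewrite !inE andbC.
  by move=> x /andP[]; exact: f0.
rewrite [leRHS](bigID (mem G))/= lerDl big_seq_cond sumr_ge0// => x /andP[xD _].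
exact: fD.
Qed.

Lemma ler_sum_fset_seq (R : numDomainType) (T : choiceType) (G : {fset T}) (f g : T -> R) :
  (forall x, x \in G -> f x <= g x) -> \sum_(x <- G) f x <= \sum_(x <- G) g x.
Proof. by move=> fg; rewrite big_seq [leRHS]big_seq; apply: ler_sum. Qed.

Section Approx.
Variables (R : realType) (d : nat) (a th dl M : R).
Hypotheses (a0 : 0 < a) (th0 : 0 <= th) (dl0 : 0 < dl).
Implicit Types (x : 'rV[R]_d) (mu : set 'rV[R]_d).

Definition cutkern r t := bump M (M + 1) t * kern th dl r t.

Let MM : M < M + 1. Proof. by rewrite ltrDl. Qed.

Lemma cutkern_ge0 r t : 0 <= r -> 0 <= cutkern r t.
Proof. by move=> r0; rewrite mulr_ge0 ?bump_ge0// kern_ge0. Qed.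

Lemma cutkern0 r t : M + 1 <= t -> cutkern r t = 0.
Proof. by move=> tM; rewrite /cutkern bump0// mul0r. Qed.

Lemma continuous_cutkern r : 0 <= r -> continuous (cutkern r).
Proof.
by move=> r0 t; apply: cvgM; [exact: continuous_bump|exact: continuous_kern].
Qed.

(** The exponent runs over all points, the nearest one included. The prefactor is
    [expR (kern th dl r r)], which cancels the contribution of a point with [tau] equal to [r] where
    the cutoff at [M] is [1]. *)
Definition approx r mu :=
  (1 + th * Num.min 1 (r / dl)) * expR (- linstat (cutkern r \o tau a) mu).

Lemma linstat_cutkern_ge0 r mu : 0 <= r -> 0 <= linstat (cutkern r \o tau a) mu.
Proof. by move=> r0; apply: linstat_ge0 => x; exact: cutkern_ge0. Qed.

Lemma prefactor_bounds r : 0 <= r -> 0 <= 1 + th * Num.min 1 (r / dl) <= 1 + th.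
Proof.
move=> r0; have q0 : 0 <= r / dl by rewrite divr_ge0// ltW.
have : 0 <= th * Num.min 1 (r / dl) by rewrite mulr_ge0// le_min ler01.
have : th * Num.min 1 (r / dl) <= th by rewrite ler_piMr// ge_min lexx.
by move=> h1 h2; apply/andP; split; lra.
Qed.

Lemma approx_bounds r mu : 0 <= r -> 0 <= approx r mu <= 1 + th.
Proof.
move=> r0; have /andP[c0 c1] := prefactor_bounds r0.
have e1 : expR (- linstat (cutkern r \o tau a) mu) <= 1.
  by rewrite -expR0 ler_expR oppr_le0 linstat_cutkern_ge0.
rewrite /approx mulr_ge0 ?expR_ge0//= -[leRHS]mulr1.
by apply: ler_pM => //; exact: expR_ge0.
Qed.

(** The prefactor moves by at most [th / dl * |r - s|], and so does each term of the exponent,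
    weighted by its bump; summing the weights gives the smoothed count of points up to [M]. *)
Lemma approx_lipschitz r s mu : locally_finite mu -> 0 <= r -> 0 <= s ->
  `|approx r mu - approx s mu| <=
  th / dl * `|r - s| * (1 + (1 + th) * linstat (bump M (M + 1) \o tau a) mu).
Proof.
move=> lf r0 s0; rewrite /approx.
set Sr := linstat (cutkern r \o tau a) mu; set Ss := linstat (cutkern s \o tau a) mu.
set N := linstat _ mu; set L := th / dl * `|r - s|.
have L0 : 0 <= L by rewrite !mulr_ge0// invr_ge0 ltW.
have dS : `|Sr - Ss| <= L * N.
  rewrite /Sr /Ss /N (linstat_tau (G := cutkern r) a0 lf (M := M + 1)); last by move=> t; exact: cutkern0.
  rewrite (linstat_tau (G := cutkern s) a0 lf (M := M + 1)); last by move=> t; exact: cutkern0.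
  rewrite (linstat_tau (G := bump M (M + 1)) a0 lf (M := M + 1)); last by move=> t; exact: bump0.
  rewrite -sumrB mulr_sumr (le_trans (ler_norm_sum _ _ _))//.
  apply: ler_sum => x _; rewrite /cutkern -mulrBr normrM ger0_norm ?bump_ge0//.
  by rewrite mulrC ler_wpM2r ?bump_ge0// kern_lipschitz.
have dc : `|(1 + th * Num.min 1 (r / dl)) - (1 + th * Num.min 1 (s / dl))| <= L.
  rewrite opprD addrACA subrr add0r -mulrBr normrM (ger0_norm th0) /L -mulrA.
  rewrite ler_wpM2l//; have -> : dl^-1 * `|r - s| = `|r / dl - s / dl|.
    by rewrite -mulrBl normrM normfV (gtr0_norm dl0) mulrC.
  move: (r / dl) (s / dl) => u v; rewrite !minEle.
  case: (leP 1 u) => hu; case: (leP 1 v) => hv; rewrite ?subrr ?normr0 ?normr_ge0//.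
  - by rewrite !ger0_norm; lra.
  - by rewrite !ler0_norm; lra.
have /andP[c0 c1] := prefactor_bounds s0.
set cr := 1 + _ in dc *; set cs := (X in `|_ - X * _|).
have -> : cr * expR (- Sr) - cs * expR (- Ss) =
  (cr - cs) * expR (- Sr) + cs * (expR (- Sr) - expR (- Ss)) by ring.
have Sr0 : 0 <= Sr by exact: linstat_cutkern_ge0.
have Ss0 : 0 <= Ss by exact: linstat_cutkern_ge0.
rewrite (le_trans (ler_normD _ _))// [leRHS]mulrDr mulr1 lerD//.
  rewrite normrM (ger0_norm (expR_ge0 _)) (le_trans _ dc)// ler_piMr//.
  by rewrite -expR0 ler_expR oppr_le0.
rewrite normrM (ger0_norm c0) mulrCA ler_pM// (le_trans (expRN_lipschitz Sr0 Ss0))//.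
Qed.

End Approx.

(** * The coverage product against its approximation *)

Section CovProduct.
Variables (R : realType) (d : nat) (beta th : R).
Let a := d%:R * beta.
Hypotheses (a0 : 0 < a) (th0 : 0 <= th).
Implicit Types (x b : 'rV[R]_d) (mu : set 'rV[R]_d).

Lemma cov_factorE b x : cov_factor th beta b x = (1 + th * (tau a b / tau a x))^-1.
Proof.
rewrite /cov_factor powRM ?invr_ge0 ?eucl_ge0// -[(eucl x)^-1]powR_inv1 ?eucl_ge0//.
by rewrite powRAC powR_inv1 ?powR_ge0.
Qed.

Let q_ge0 b x : 0 <= th * (tau a b / tau a x).
Proof. by rewrite mulr_ge0// divr_ge0// tau_ge0. Qed.

Lemma prod_cov_factor b (F : {fset 'rV[R]_d}) :
  \big[*%R/1]_(x <- F) cov_factor th beta b x =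
  expR (- \sum_(x <- F) ln (1 + th * (tau a b / tau a x))).
Proof.
rewrite -sumrN (big_morph expR (@expRD R) (@expR0 R)); apply: eq_bigr => x _.
rewrite cov_factorE expRN lnK// posrE; have := q_ge0 b x; lra.
Qed.

Definition cov_partial mu b := [set p | exists F : set 'rV[R]_d,
         [/\ finite_set F, F `<=` mu `\ b &
             p = (\big[*%R/1%R]_(x \in F) cov_factor th beta b x)%R]].

Lemma cov_partialP mu b p : cov_partial mu b p <->
  exists2 F : {fset 'rV[R]_d}, (forall x, x \in F -> mu x /\ x != b) &
    p = expR (- \sum_(x <- F) ln (1 + th * (tau a b / tau a x))).
Proof.
split=> [[F [fF Fmu ->]]|[F Fmu ->]].
  have /finite_fsetP[G FG] := fF; rewrite FG in Fmu *.
  exists G; first by move=> x xG; have [? /eqP] := Fmu x xG.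
  by rewrite -prod_cov_factor -fsbig_seq.
exists [set` F]; split; first exact: finite_fset.
  by move=> x /= /Fmu[? /eqP].
by rewrite -prod_cov_factor -fsbig_seq.
Qed.

(** With [S] the exponent of [approx] without the term of [b], every finite partial product is at
    least [expR (- S)] up to the tail error. Conversely, the partial product over the points with
    [tau] at most [M + 1] is at most [expR (- S)], because the cutoff only decreases the
    exponent. *)
Lemma cov_product_approx mu b dl M eta : 0 < dl -> locally_finite mu ->
  b = least_point mu -> mu b -> (forall x, mu x -> x != b -> dl <= tau a x) ->
  tau a b <= M ->
  (forall F : {fset 'rV[R]_d}, (forall x, x \in F -> mu x /\ M < tau a x) ->
    \sum_(x <- F) (tau a x)^-1 <= eta) ->
  `|cov_product th beta mu - approx a th dl M (tau a b) mu| <= th * tau a b * eta.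
Proof.
move=> dl0 lf be mb mdl bM tail.
have -> : cov_product th beta mu = inf (cov_partial mu b) by rewrite be.
set rho := tau a b; have rho0 : 0 <= rho by exact: tau_ge0.
set l := fun x => ln (1 + th * (rho / tau a x)).
have l0 x : 0 <= l x by apply: ln_ge0; rewrite lerDl; exact: q_ge0.
have kl x : mu x -> x != b -> kern th dl rho (tau a x) = l x.
  by move=> mx xb; rewrite /kern max_l// mdl.
set g := fun x => bump M (M + 1) (tau a x) * l x.
have g0 x : 0 <= g x by rewrite mulr_ge0// bump_ge0.
have gl x : g x <= l x by rewrite ler_piMl// bump_le1.
have MM : M < M + 1 by rewrite ltrDl.
pose D := (tau_trace a (M + 1) mu `\ b)%fset.
have DP x : x \in D -> mu x /\ x != b.
  by rewrite in_fsetD1 => /andP[xb /(tau_traceP (M + 1) a0 lf)[]].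
have -> : approx a th dl M rho mu = expR (- \sum_(x <- D) g x).
  rewrite /approx (linstat_tau a0 lf (M := M + 1)); last by move=> t; exact: cutkern0.
  rewrite (big_fsetD1 b)/=; last first.
    by apply/(tau_traceP (M + 1) a0 lf); split => //; rewrite (le_trans bM)// ltW.
  (* The prefactor cancels the term of [b], whose bump is [1] since [tau a b <= M]. *)
  rewrite opprD expRD mulrA [X in X * _](_ : _ = 1) ?mul1r.
    congr (expR (- _)); apply: eq_big_seq => x /DP[mx xb].
    by rewrite /cutkern kl.
  rewrite /cutkern bump1// mul1r expRN /kern.
  have -> : tau a b / Num.max (tau a b) dl = Num.min 1 (rho / dl).
    rewrite -/rho; have [h|h] := leP dl rho.
      by rewrite divff ?gt_eqF ?(lt_le_trans dl0)// min_l// ler_pdivlMr// mul1r.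
    by rewrite min_r// ler_pdivrMr// mul1r ltW.
  have c1 : 0 <= th * Num.min 1 (rho / dl).
    by rewrite mulr_ge0// le_min ler01 divr_ge0// ltW.
  by rewrite lnK ?posrE ?divff ?gt_eqF//; lra.
have E1 : expR (- \sum_(x <- D) g x) <= 1.
  by rewrite -expR0 ler_expR oppr_le0 sumr_ge0.
have eta0 : 0 <= eta.
  by have := tail fset0; rewrite big_seq_fset0; apply => x; rewrite inE.
have x0 : 0 <= th * rho * eta by rewrite !mulr_ge0.
have lower p : cov_partial mu b p ->
    expR (- \sum_(x <- D) g x) - th * rho * eta <= p.
  move=> /cov_partialP[F Fmu ->].
  have Fl : \sum_(x <- F) l x <= \sum_(x <- D) g x + th * rho * eta.
    (* The part of [l] removed by the cutoff vanishes up to [M]; beyond [M] it is at most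
       [th * rho / tau a x] by [ln (1 + u) <= u], which the tail bound sums to [th * rho * eta]. *)
    have -> : \sum_(x <- F) l x = \sum_(x <- F) g x +
        \sum_(x <- F) (1 - bump M (M + 1) (tau a x)) * l x.
      by rewrite -big_split/=; apply: eq_bigr => x _; rewrite /g; ring.
    apply: lerD.
      apply: ler_sum_fset => // x xF xD; have [mx xb] := Fmu x xF.
      rewrite /g bump0 ?mul0r// leNgt; apply: contra xD => xM.
      by rewrite in_fsetD1 xb/=; apply/(tau_traceP (M + 1) a0 lf); split => //; exact: ltW.
    apply: (@le_trans _ _ (\sum_(x <- F | M < tau a x) th * rho * (tau a x)^-1)).
      rewrite [leRHS]big_mkcond; apply: ler_sum => x _; case: ltP => xM.
        apply: (@le_trans _ _ (l x)).
          by rewrite ler_piMl// lerBlDr lerDl bump_ge0.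
        by rewrite -mulrA; apply: le_ln1Dx; apply: lt_le_trans (q_ge0 b x); rewrite ltrN10.
      by rewrite bump1// subrr mul0r.
    rewrite -mulr_sumr ler_wpM2l ?mulr_ge0// big_fset_condE tail// => x.
    by rewrite !inE/= => /andP[/Fmu[]].
  (* For [0 <= e <= 1] and [y >= 0], [e * expR (- y) >= e * (1 - y) >= e - y]. *)
  apply: (@le_trans _ _ (expR (- \sum_(x <- D) g x) * expR (- (th * rho * eta)))); last first.
    by rewrite -expRD -opprD ler_expR lerN2.
  have := expR_ge1Dx (- (th * rho * eta)); have := expR_ge0 (- \sum_(x <- D) g x).
  by move: E1 x0; set e := expR _; set y := th * rho * eta => *; nra.
have ub : cov_partial mu b (expR (- \sum_(x <- D) l x)).
  by apply/cov_partialP; exists D.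
have lb : has_lbound (cov_partial mu b).
  by exists (expR (- \sum_(x <- D) g x) - th * rho * eta) => p; exact: lower.
rewrite ler0_norm; last first.
  rewrite subr_le0 (le_trans (ge_inf lb ub))// ler_expR lerN2.
  by apply: ler_sum => x _.
rewrite opprB lerBlDl -lerBlDr; apply: lb_le_inf; first by eexists; exact: ub.
exact: lower.
Qed.

Lemma cov_product_bounds mu : 0 <= cov_product th beta mu <= 1.
Proof.
have -> : cov_product th beta mu = inf (cov_partial mu (least_point mu)) by [].
have one : cov_partial mu (least_point mu) 1.
  apply/cov_partialP; exists fset0; first by move=> x; rewrite inE.
  by rewrite big_seq_fset0 oppr0 expR0.
have pos p : cov_partial mu (least_point mu) p -> 0 <= p.
  by move=> /cov_partialP[F _ ->]; exact: expR_ge0.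
apply/andP; split; first by apply: lb_le_inf => //; eexists; exact: one.
by apply: ge_inf => //; exists 0.
Qed.

(** A minimiser over the finitely many points no farther than a given point [y] is a global one; its
    existence excludes the default value [0] of [xget]. *)
Lemma least_pointP mu : locally_finite mu -> mu !=set0 ->
  mu (least_point mu) /\ forall x, mu x -> tau a (least_point mu) <= tau a x.
Proof.
move=> lf [y my].
suff H : exists b, [set b | mu b /\ forall y, mu y -> eucl b <= eucl y] b.
  have [mb bl] := xgetPex 0 H.
  by split => // x mx; rewrite tau_mono// bl.
pose D := tau_trace a (tau a y) mu.
have DP := tau_traceP (tau a y) a0 lf.
have yD : y \in D by apply/DP.
have [[b' b'D] _ /= bl] :=
  @arg_minP _ _ _ [` yD]%fset predT (fun z : D => tau a (val z)) isT.
have [mb' _] := (DP b').1 b'D.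
exists b'; split => // z mz; rewrite -(tau_mono a0).
have [zy|yz] := leP (tau a z) (tau a y).
  have zD : z \in D by apply/DP.
  exact: (bl [` zD]%fset isT).
by rewrite (le_trans (bl [` yD]%fset isT))//= ltW.
Qed.

End CovProduct.

(** * Averaging over a grid of radii *)

Section Grid.
Variables (R : realType) (d : nat) (a : R).
Hypothesis a0 : 0 < a.
Implicit Types (x : 'rV[R]_d) (mu : set 'rV[R]_d).

Definition bumpstat lo hi mu : R := linstat (bump lo hi \o tau a) mu.

Lemma bumpstat_ge0 lo hi mu : 0 <= bumpstat lo hi mu.
Proof. by apply: linstat_ge0 => x; exact: bump_ge0. Qed.

Lemma bumpstatE lo hi mu : lo < hi -> locally_finite mu ->
  bumpstat lo hi mu = \sum_(x <- tau_trace a hi mu) bump lo hi (tau a x).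
Proof. by move=> lh lf; apply: linstat_tau => // t; exact: bump0. Qed.

Lemma linstat_tau_ge (G : R -> R) M mu (F : {fset 'rV[R]_d}) :
  locally_finite mu -> (forall t, 0 <= G t) -> (forall t, M <= t -> G t = 0) ->
  (forall x, x \in F -> mu x) -> \sum_(x <- F) G (tau a x) <= linstat (G \o tau a) mu.
Proof.
move=> lf G0 GM Fmu; rewrite (linstat_tau a0 lf GM).
apply: ler_sum_fset => // x /Fmu mx xD; apply: GM; rewrite leNgt.
by apply: contra xD => xM; apply/(tau_traceP M a0 lf); split => //; exact: ltW.
Qed.

Lemma bumpstat_ge1 lo hi mu x : lo < hi -> locally_finite mu -> mu x -> tau a x <= lo ->
  1 <= bumpstat lo hi mu.
Proof.
move=> lh lf mx xl.
have := @linstat_tau_ge (bump lo hi) hi mu [fset x]%fset lf (bump_ge0 lo hi) (fun t => bump0 lh).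
by rewrite big_seq_fset1 bump1//; apply => y; rewrite inE => /eqP ->.
Qed.

Lemma bumpstat_ge2 lo hi mu x y : lo < hi -> locally_finite mu -> mu x -> mu y -> x != y ->
  tau a x <= lo -> tau a y <= lo -> 2 <= bumpstat lo hi mu.
Proof.
move=> lh lf mx my xy xl yl.
have := @linstat_tau_ge (bump lo hi) hi mu [fset x; y]%fset lf (bump_ge0 lo hi) (fun t => bump0 lh).
rewrite big_fsetU1 ?inE//= big_seq_fset1 !bump1//; apply => z.
by rewrite !inE => /orP[] /eqP ->.
Qed.

Lemma bumpstat_eq0 lo hi mu : lo < hi -> locally_finite mu ->
  (forall x, mu x -> hi <= tau a x) -> bumpstat lo hi mu = 0.
Proof.
move=> lh lf far; rewrite bumpstatE// big_seq big1// => x /(tau_traceP hi a0 lf)[mx _].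
by apply: bump0 => //; exact: far.
Qed.

(** Wherever the first bump is nonzero, the second one equals [1]. This makes [cell] nondecreasing
    in its index. *)
Lemma bumpstat_le lo mid hi mu : lo < mid -> mid < hi -> locally_finite mu ->
  bumpstat lo mid mu <= bumpstat mid hi mu.
Proof.
move=> lm mh lf; rewrite bumpstatE//.
apply: le_trans (_ : \sum_(x <- tau_trace a mid mu) bump mid hi (tau a x) <= _).
  apply: ler_sum_fset_seq => x /(tau_traceP mid a0 lf)[_ xm].
  by rewrite [leRHS]bump1// bump_le1.
apply: (@linstat_tau_ge _ hi) => // [t|t|x /(tau_traceP mid a0 lf)[]//].
  exact: bump_ge0.
exact: bump0.
Qed.

Variables (th dl M h : R).
Hypotheses (th0 : 0 <= th) (dl0 : 0 < dl) (h0 : 0 < h).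

(* The indicator that the least value of [tau] over the configuration is below
   [i * h], smoothed over one grid step. *)
Definition cell (i : nat) mu : R :=
  if i is j.+1 then clamp (bumpstat (j%:R * h) (j.+1%:R * h) mu) else 0.

(** A Riemann-Stieltjes sum of [r |-> approx r mu] against a smoothed distribution function of the
    least value of [tau]. *)
Definition gridapprox (n : nat) mu : R :=
  \sum_(i < n) (cell i.+1 mu - cell i mu) * approx a th dl M (i%:R * h) mu.

Let gridS (i : nat) : i%:R * h < i.+1%:R * h.
Proof. by rewrite ltr_pM2r// ltr_nat. Qed.

Let grid_ge0 (i : nat) : 0 <= i%:R * h.
Proof. by rewrite mulr_ge0// ltW. Qed.

Lemma cell_bounds i mu : 0 <= cell i mu <= 1.
Proof. by case: i => [|i]; rewrite ?lexx ?ler01//= clamp_ge0 clamp_le1. Qed.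

Lemma cell_le i mu : locally_finite mu -> cell i mu <= cell i.+1 mu.
Proof.
move=> lf; case: i => [|i]; first by have /andP[] := cell_bounds 1 mu.
by apply: clamp_le; exact: bumpstat_le.
Qed.

(** A crude bound valid for every set [mu], as [vague_bounded_continuous] demands; the sharper
    [gridapprox_bounds] relies on local finiteness. *)
Lemma norm_gridapprox n mu : `|gridapprox n mu| <= n%:R * (1 + th).
Proof.
rewrite (le_trans (ler_norm_sum _ _ _))// mulr_natl -[X in _ *+ X]card_ord -sumr_const.
apply: ler_sum => i _; have /andP[A0 A1] := approx_bounds a M th0 dl0 mu (grid_ge0 i).
have /andP[c0 c1] := cell_bounds i mu; have /andP[c0' c1'] := cell_bounds i.+1 mu.
rewrite normrM (ger0_norm A0) -[leRHS]mul1r ler_pM// ler_norml.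
by apply/andP; split; lra.
Qed.

Let sum_cell n mu : \sum_(i < n) (cell i.+1 mu - cell i mu) = cell n mu.
Proof.
by rewrite -(big_mkord xpredT (fun i => cell i.+1 mu - cell i mu)) telescope_sumr// subr0.
Qed.

Lemma gridapprox_bounds n mu : locally_finite mu -> 0 <= gridapprox n mu <= 1 + th.
Proof.
move=> lf; apply/andP; split.
  apply: sumr_ge0 => i _; have /andP[A0 _] := approx_bounds a M th0 dl0 mu (grid_ge0 i).
  by rewrite mulr_ge0// subr_ge0 cell_le.
apply: (@le_trans _ _ (\sum_(i < n) (cell i.+1 mu - cell i mu) * (1 + th))).
  apply: ler_sum => i _; have /andP[_ A1] := approx_bounds a M th0 dl0 mu (grid_ge0 i).
  by rewrite ler_wpM2l// subr_ge0 cell_le.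
have /andP[_ c1] := cell_bounds n mu.
by rewrite -mulr_suml sum_cell ler_piMl// addr_ge0.
Qed.

(** The weights are nonnegative, sum to [1], and vanish unless [i * h] is within [h] of [tau a b];
    for the remaining indices [approx_lipschitz] applies. *)
Lemma gridapprox_error n mu b : locally_finite mu -> mu b ->
  (forall x, mu x -> tau a b <= tau a x) -> tau a b <= n%:R * h ->
  `|approx a th dl M (tau a b) mu - gridapprox n.+1 mu| <=
  th / dl * h * (1 + (1 + th) * bumpstat M (M + 1) mu).
Proof.
move=> lf mb bmin bn; set err := leRHS.
have err0 : 0 <= err.
  have N0 := bumpstat_ge0 M (M + 1) mu.
  by rewrite /err mulr_ge0 ?mulr_ge0 ?invr_ge0 ?(ltW dl0) ?(ltW h0)// addr_ge0// mulr_ge0// addr_ge0.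
(* The smoothing costs one grid step: a point with [tau] at most [n * h] saturates [cell n.+1], not
   [cell n]. *)
have top : cell n.+1 mu = 1 by rewrite /= clamp1// (@bumpstat_ge1 _ _ _ b).
have -> : approx a th dl M (tau a b) mu =
    \sum_(i < n.+1) (cell i.+1 mu - cell i mu) * approx a th dl M (tau a b) mu.
  by rewrite -mulr_suml sum_cell top mul1r.
rewrite -sumrB (le_trans (ler_norm_sum _ _ _))//.
apply: (@le_trans _ _ (\sum_(i < n.+1) (cell i.+1 mu - cell i mu) * err)); last first.
  by rewrite -mulr_suml sum_cell top mul1r.
apply: ler_sum => i _; rewrite -mulrBr normrM ger0_norm ?subr_ge0 ?cell_le//.
have [bi|bi] := ltP (i.+1%:R * h) (tau a b).
  have z1 : cell i.+1 mu = 0.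
    rewrite /= clamp0// bumpstat_eq0// => x mx; rewrite (le_trans (ltW bi))//; exact: bmin.
  have z0 : cell i mu = 0.
    by apply/eqP; rewrite eq_le -{1}z1 cell_le//; have /andP[->] := cell_bounds i mu.
  by rewrite z1 z0 subrr !mul0r.
(* Here [i] is positive, and already the preceding grid point lies above [tau a b], so both cells
   equal [1]. *)
have [ib|ib] := ltP (tau a b + h) (i%:R * h).
  have [j ij] : exists j, nat_of_ord i = j.+1.
    case: (nat_of_ord i) ib => [|j _]; last by exists j.
    by rewrite mul0r => hb; have := tau_ge0 a b; have := h0; lra.
  rewrite !ij in ib *.
  have jb : tau a b <= j%:R * h by move: ib h0; rewrite -natr1 mulrDl mul1r; lra.
  rewrite /= !clamp1 ?subrr ?mul0r//; apply: (@bumpstat_ge1 _ _ _ b) => //.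
  by rewrite (le_trans jb)// ltW.
rewrite ler_wpM2l ?subr_ge0 ?cell_le//.
rewrite (le_trans (approx_lipschitz M a0 th0 dl0 lf (tau_ge0 _ _) (grid_ge0 i)))//.
rewrite /err /bumpstat ler_wpM2r//.
  by rewrite addr_ge0// mulr_ge0 ?bumpstat_ge0// addr_ge0.
rewrite ler_wpM2l ?divr_ge0 ?(ltW dl0)// ler_norml.
by move: bi ib h0; rewrite -natr1 mulrDl mul1r => *; apply/andP; split; lra.
Qed.

End Grid.

(** * Pointwise estimate outside the bad events *)

Section MainEstimate.
Variables (R : realType) (d : nat) (beta th : R).
Let a := d%:R * beta.
Hypotheses (a0 : 0 < a) (th0 : 0 <= th).
Implicit Types (x : 'rV[R]_d) (mu : set 'rV[R]_d).

Lemma tailsum_ge r mu (F : {fset 'rV[R]_d}) :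
  (forall x, x \in F -> mu x /\ r < eucl x) ->
  ((\sum_(x <- F) (tau a x)^-1)%:E <= tailsum beta r mu)%E.
Proof.
move=> Fmu; rewrite /tailsum; apply: esum_ge; exists [set` F].
  by split; [exact: finite_fset|move=> x /= /Fmu].
by rewrite -fsbig_seq// sumEFin.
Qed.

(** This and the next two are continuous majorants of indicators of bad events: no point with [tau]
    below [t + 1], a smoothed count up to [M] of at least [K + 1], two points with [tau] at most
    [dl]. *)
Definition void_defect t mu : R := clamp (1 - bumpstat a t (t + 1) mu).
Definition crowd_defect M K mu : R := clamp (bumpstat a M (M + 1) mu - K).
Definition pair_defect dl mu : R := clamp (bumpstat a dl (dl + dl) mu - 1).
Definition tail_event r eta : set (set 'rV[R]_d) :=
  [set mu | (eta%:E < tailsum beta r mu)%E].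

(** If the defects and the tail indicator sum to at least [1], the bound is trivial, both quantities
    lying in [[0, 1 + th]]. Otherwise no bad event occurs, since each would force its own term to be
    [1], and the errors of [cov_product_approx] and [gridapprox_error] add up. *)
Lemma gridapprox_estimate mu t dl M K h r eta n :
  locally_finite mu -> mu !=set0 -> 0 < dl -> 0 < h -> 0 <= r -> 0 <= t ->
  t + 1 <= M -> r `^ a <= M -> t + 1 <= n%:R * h -> 0 <= K -> 0 <= eta ->
  `|cov_product th beta mu - gridapprox a th dl M h n.+1 mu| <=
  (th * (t + 1) * eta + th / dl * h * (1 + (1 + th) * (K + 1))) +
  (1 + th) * (void_defect t mu + crowd_defect M K mu + pair_defect dl mu +
              \1_(tail_event r eta) mu).
Proof.
move=> lf ne dl0 h0 r0 t0 tM rM tn K0 eta0; have th0' := th0; set err := th * (t + 1) * eta + _; set D := _ + \1_(_) mu.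
have err0 : 0 <= err.
  rewrite /err !addr_ge0 ?mulr_ge0 ?invr_ge0 ?(ltW dl0) ?(ltW h0)//.
  - by rewrite addr_ge0.
  - by rewrite addr_ge0// mulr_ge0// addr_ge0.
have vT0 : 0 <= void_defect t mu by exact: clamp_ge0.
have vK0 : 0 <= crowd_defect M K mu by exact: clamp_ge0.
have vd0 : 0 <= pair_defect dl mu by exact: clamp_ge0.
have i0 : 0 <= \1_(tail_event r eta) mu :> R by rewrite indicE.
have th1 : 0 <= 1 + th by rewrite addr_ge0.
have D0 : 0 <= D by rewrite /D !addr_ge0.
have [D1|D1] := leP 1 D.
  have /andP[c0 c1] := cov_product_bounds beta th0 mu.
  have /andP[g0 g1] := gridapprox_bounds a0 M th0 dl0 h0 n.+1 lf.
  rewrite (@le_trans _ _ (1 + th))//.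
    by rewrite ler_norml; apply/andP; split; lra.
  by rewrite -[leLHS]add0r lerD// -[leLHS]mulr1 ler_wpM2l//; lra.
have dl2 : dl < dl + dl by rewrite ltrDl.
have MM : M < M + 1 by rewrite ltrDl.
have tt1 : t < t + 1 by rewrite ltrDl.
have [mb bmin] := least_pointP a0 lf ne; set b := least_point mu in mb bmin.
have bt : tau a b <= t + 1.
  rewrite leNgt; apply/negP => tb.
  have : void_defect t mu = 1.
    rewrite /void_defect (bumpstat_eq0 a0)// ?subr0 ?clamp1// => x mx.
    by rewrite (le_trans (ltW tb))// bmin.
  by move: D1; rewrite /D; lra.
have far x : mu x -> x != b -> dl <= tau a x.
  move=> mx xb; rewrite leNgt; apply/negP => xdl.
  have : pair_defect dl mu = 1.
    rewrite /pair_defect clamp1// lerBrDr.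
    by apply: (bumpstat_ge2 a0 dl2 lf mx mb xb) => //; rewrite ltW// (le_lt_trans (bmin _ mx)).
  by move: D1; rewrite /D; lra.
have few : bumpstat a M (M + 1) mu <= K + 1.
  rewrite leNgt; apply/negP => Kb.
  have : crowd_defect M K mu = 1 by rewrite /crowd_defect clamp1//; lra.
  by move: D1; rewrite /D; lra.
have tail : (tailsum beta r mu <= eta%:E)%E.
  rewrite leNgt; apply/negP => tl.
  have : \1_(tail_event r eta) mu = 1 :> R by rewrite indicE mem_set.
  by move: D1; rewrite /D; lra.
have bM : tau a b <= M by rewrite (le_trans bt).
have tail' (F : {fset 'rV[R]_d}) : (forall x, x \in F -> mu x /\ M < tau a x) ->
    \sum_(x <- F) (tau a x)^-1 <= eta.
  move=> Fmu; rewrite -lee_fin; apply: le_trans tail; apply: tailsum_ge => x /Fmu[mx Mx].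
  by split => //; rewrite -(tau_gt a0 _ r0) (le_lt_trans rM).
have e1 := cov_product_approx a0 th0 dl0 lf (erefl b) mb far bM tail'.
have e2 := gridapprox_error a0 M th0 dl0 h0 lf mb bmin (le_trans bt tn).
rewrite (@le_trans _ _ err)//; last by rewrite lerDl mulr_ge0//; lra.
set A := approx _ _ _ _ _ _ in e1 e2.
rewrite (le_trans (ler_distD A _ _))// /err lerD//.
  by rewrite (le_trans e1)// ler_wpM2r// ler_wpM2l.
rewrite (le_trans e2)// ler_wpM2l ?mulr_ge0 ?invr_ge0 ?(ltW dl0) ?(ltW h0)//.
by rewrite lerD// ler_wpM2l//; lra.
Qed.

End MainEstimate.

(** * Vague continuity and measurability *)

Section VagueFilter.
Variables (R : realType) (d : nat).
Implicit Types (mu nu : set 'rV[R]_d) (f : set 'rV[R]_d -> R).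

(** Turns [vague_continuous_at] into a limit along a filter, so that the usual rules for limits
    apply. *)
Definition vague_nbhs mu : set_system (set 'rV[R]_d) :=
  [set U | exists (k : nat) (gs : 'I_k -> 'rV[R]_d -> R) (delta : R),
    (forall i, Cc (gs i)) /\ 0 < delta /\
    forall nu, locally_finite nu ->
      (forall i, `|linstat (gs i) nu - linstat (gs i) mu| < delta) -> U nu].

#[global] Instance vague_nbhs_filter mu : Filter (vague_nbhs mu).
Proof.
split.
- by exists 0%N, (fun=> cst 0), 1; split => [[]//|]; split.
- move=> U V [k [gs [dl [gC [dl0 gU]]]]] [k' [gs' [dl' [gC' [dl0' gV]]]]].
  (* An intersection is witnessed by the concatenated families of test functions and the smaller
     tolerance. *)
  exists (k + k')%N, (fun i => match fintype.split i with inl j => gs j | inr j => gs' j end),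
    (Num.min dl dl'); split; first by move=> i; case: (fintype.split i).
  split; first by rewrite lt_min dl0.
  move=> nu lf H; split.
    apply: gU => // i; have := H (lshift k' i).
    by rewrite -[lshift k' i]/(unsplit (inl i)) unsplitK lt_min => /andP[].
  apply: gV => // i; have := H (rshift k i).
  by rewrite -[rshift k i]/(unsplit (inr i)) unsplitK lt_min => /andP[].
- move=> U V UV [k [gs [dl [gC [dl0 gU]]]]]; exists k, gs, dl; split => //; split => //.
  by move=> nu lf H; apply: UV; exact: gU.
Qed.

Lemma vague_continuous_atP f mu :
  vague_continuous_at f mu <-> f nu @[nu --> vague_nbhs mu] --> f mu.
Proof.
split.
  by move=> fc; apply/cvgrPdistC_lt => e e0; exact: fc.
by move=> /cvgrPdistC_lt fc e e0; exact: fc.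
Qed.

Lemma cvg_linstat g mu : Cc g -> linstat g nu @[nu --> vague_nbhs mu] --> linstat g mu.
Proof.
move=> gC; apply/vague_continuous_atP => e e0; exists 1%N, (fun=> g), e.
by split => //; split => // nu _ /(_ ord0).
Qed.

Variables (dO : measure_display) (O : measurableType dO).

(** Continuity and measurability are carried together, since both pass to sums, products and
    compositions with continuous real functions. *)
Definition vague_functional f :=
  (forall mu, f nu @[nu --> vague_nbhs mu] --> f mu) /\
  (forall X : O -> set 'rV[R]_d, point_process X -> measurable_fun setT (f \o X)).

Lemma vague_functional_linstat g : Cc g -> vague_functional (linstat g).
Proof.
move=> gC; split => [mu|X [_ mX]]; first exact: cvg_linstat.
exact: mX.
Qed.

Lemma vague_functional_cst c : vague_functional (fun=> c).
Proof. by split => [mu|X _]; [exact: cvg_cst|exact: measurable_cst]. Qed.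

Lemma vague_functional_add f g : vague_functional f -> vague_functional g ->
  vague_functional (fun mu => f mu + g mu).
Proof.
move=> [cf mf] [cg mg]; split => [mu|X pX]; first exact: cvgD.
by apply: measurable_funD; [exact: mf|exact: mg].
Qed.

Lemma vague_functional_mul f g : vague_functional f -> vague_functional g ->
  vague_functional (fun mu => f mu * g mu).
Proof.
move=> [cf mf] [cg mg]; split => [mu|X pX]; first exact: cvgM.
by apply: measurable_funM; [exact: mf|exact: mg].
Qed.

Lemma vague_functional_comp (phi : R -> R) f : continuous phi -> vague_functional f ->
  vague_functional (fun mu => phi (f mu)).
Proof.
move=> cphi [cf mf]; split => [mu|X pX].
  by apply: (@continuous_cvg _ _ _ _ _ f phi (f mu)); [exact: cphi|exact: cf].
apply: (@measurableT_comp _ _ _ _ _ _ phi); last exact: mf.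
exact: continuous_measurable_fun.
Qed.

Lemma vague_functional_opp f : vague_functional f -> vague_functional (fun mu => - f mu).
Proof. by apply: vague_functional_comp; exact: opp_continuous. Qed.

Lemma vague_functional_sum n (F : 'I_n -> set 'rV[R]_d -> R) :
  (forall i, vague_functional (F i)) -> vague_functional (fun mu => \sum_(i < n) F i mu).
Proof.
elim: n F => [|n IH] F vF.
  under [X in vague_functional X]eq_fun do rewrite big_ord0.
  exact: vague_functional_cst.
under [X in vague_functional X]eq_fun do rewrite big_ord_recl.
by apply: vague_functional_add => //; apply: IH.
Qed.

Lemma vague_functional_bounded f M : vague_functional f -> (forall mu, `|f mu| <= M) ->
  vague_bounded_continuous f.
Proof.
by move=> [cf _] fM; split; [exists M|move=> mu _; apply/vague_continuous_atP; exact: cf].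
Qed.

End VagueFilter.

(** * Vague continuity of the approximating functionals *)

Section TauFunctionals.
Variables (R : realType) (d : nat) (a : R).
Hypothesis a0 : 0 < a.
Variables (dO : measure_display) (O : measurableType dO).
Local Notation vague_functional := (@vague_functional R d dO O).

Lemma vague_functional_tau (G : R -> R) M : continuous G -> (forall t, M <= t -> G t = 0) ->
  vague_functional (linstat (G \o tau a)).
Proof. by move=> cG GM; apply: vague_functional_linstat; exact: (Cc_tau _ a0 cG GM). Qed.

Lemma vague_functional_bumpstat lo hi : lo < hi -> vague_functional (bumpstat a lo hi).
Proof.
move=> lh; apply: (@vague_functional_tau _ hi); first exact: continuous_bump.
by move=> t; exact: bump0.
Qed.

Variables (th dl M h : R).
Hypotheses (th0 : 0 <= th) (dl0 : 0 < dl) (h0 : 0 < h).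

Lemma vague_functional_approx r : 0 <= r -> vague_functional (approx a th dl M r).
Proof.
move=> r0; apply: vague_functional_mul; first exact: vague_functional_cst.
apply: (vague_functional_comp (@continuous_expR R)); apply: vague_functional_opp.
apply: (@vague_functional_tau _ (M + 1)); first exact: continuous_cutkern.
by move=> t; exact: cutkern0.
Qed.

Lemma vague_functional_clamp f : vague_functional f -> vague_functional (fun mu => clamp (f mu)).
Proof. by apply: vague_functional_comp; exact: continuous_clamp. Qed.

Lemma vague_functional_cell i : vague_functional (cell a h i).
Proof.
case: i => [|i] /=; first exact: vague_functional_cst.
apply: vague_functional_clamp; apply: vague_functional_bumpstat.
by rewrite ltr_pM2r// ltr_nat.
Qed.

Lemma vague_functional_gridapprox n : vague_functional (gridapprox a th dl M h n).
Proof.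
apply: vague_functional_sum => i; apply: vague_functional_mul; last first.
  by apply: vague_functional_approx; rewrite mulr_ge0// ltW.
apply: vague_functional_add; first exact: vague_functional_cell.
by apply: vague_functional_opp; exact: vague_functional_cell.
Qed.

End TauFunctionals.

(** * Measurability of the tail event *)

Section TailEvent.
Variables (R : realType) (d : nat) (beta : R).
Let a := d%:R * beta.
Hypothesis a0 : 0 < a.
Variables (dO : measure_display) (O : measurableType dO).

(* As [n] grows these increase to the indicator of ]s, +oo[ divided by [t]. *)
Definition tailcut (s : R) (n : nat) (t : R) : R :=
  clamp (n%:R * (t - s)) * clamp (n%:R - t) * (Num.max t s)^-1.

Lemma continuous_tailcut s n : 0 < s -> continuous (tailcut s n).
Proof.
move=> s0 t; apply: cvgM; last first.
  apply: cvgV; first by rewrite gt_eqF// lt_max s0 orbT.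
  by apply: (@continuous_max R R id (cst s)); [exact: cvg_id|exact: cvg_cst].
apply: cvgM.
  apply: (@continuous_comp _ _ _ (fun t : R => n%:R * (t - s)) (@clamp R)).
    by apply: cvgMr; apply: cvgB; [exact: cvg_id|exact: cvg_cst].
  exact: continuous_clamp.
apply: (@continuous_comp _ _ _ (fun t : R => n%:R - t) (@clamp R)).
  by apply: cvgB; [exact: cvg_cst|exact: cvg_id].
exact: continuous_clamp.
Qed.

Lemma tailcut_ge0 s n t : 0 < s -> 0 <= tailcut s n t.
Proof.
by move=> s0; rewrite !mulr_ge0 ?clamp_ge0// invr_ge0 le_max (ltW s0) orbT.
Qed.

Lemma tailcut_eq0_near s n t : t <= s -> tailcut s n t = 0.
Proof. by move=> ts; rewrite /tailcut clamp0 ?mul0r// mulr_ge0_le0// subr_le0. Qed.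

Lemma tailcut_eq0_far s n t : n%:R <= t -> tailcut s n t = 0.
Proof. by move=> nt; rewrite /tailcut (@clamp0 _ (_ - t)) ?mulr0 ?mul0r// subr_le0. Qed.

Lemma tailcut_le s n t : 0 < s -> s < t -> tailcut s n t <= t^-1.
Proof.
move=> s0 st; rewrite /tailcut max_l ?(ltW st)// ler_piMl ?invr_ge0 ?(ltW (lt_trans s0 st))//.
by rewrite mulr_ile1 ?clamp_ge0 ?clamp_le1.
Qed.

(** The bound on [n] saturates both clamps: [n * (t - s) >= 1] and [n - t >= 1]. *)
Lemma tailcut_eq s n t : s < t -> (t - s)^-1 + (t + 1) <= n%:R -> 0 < s ->
  tailcut s n t = t^-1.
Proof.
move=> st nt s0; have v0 : 0 < (t - s)^-1 by rewrite invr_gt0 subr_gt0.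
rewrite /tailcut max_l ?ltW// !clamp1 ?mul1r//; first by lra.
by rewrite -ler_pdivrMr ?subr_gt0// div1r; lra.
Qed.

(** A tail sum above [eta] has a finite partial sum above [eta], and a large [n] leaves its terms
    uncut; conversely [tailcut] never exceeds the true summand. The event becomes a countable union
    of conditions on linear statistics. *)
Lemma tail_eventE r eta (mu : set 'rV[R]_d) : 0 < r -> locally_finite mu ->
  tail_event beta r eta mu <-> exists n, eta < linstat (tailcut (r `^ a) n \o tau a) mu.
Proof.
move=> r0 lf; have s0 : 0 < r `^ a by exact: powR_gt0.
set s := r `^ a in s0 *; split.
  rewrite /tail_event/= /tailsum /esum => /ereal_sup_gt[_ /= [A [fA Amu] <-]].
  have /finite_fsetP[F FA] := fA; rewrite FA -fsbig_seq// sumEFin lte_fin => eF.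
  have FP x : x \in F -> mu x /\ s < tau a x.
    move=> xF; have [mx rx] : mu x /\ r < eucl x by apply: Amu; rewrite FA.
    by split => //; rewrite tau_gt// ltW.
  (* A sum of nonnegative terms dominates each of them, so one [n] above [B] meets the threshold of
     [tailcut_eq] at every point of [F]. *)
  pose B := \sum_(x <- F) ((tau a x - s)^-1 + (tau a x + 1)).
  have term0 x : x \in F -> 0 <= (tau a x - s)^-1 + (tau a x + 1).
    by move=> /FP[_ sx]; rewrite !addr_ge0 ?tau_ge0// invr_ge0 subr_ge0 ltW.
  have B0 : 0 <= B by rewrite /B big_seq sumr_ge0.
  exists (Num.bound B); apply: (lt_le_trans eF).
  have FE : \sum_(x <- F) (eucl x `^ a)^-1 = \sum_(x <- F) tailcut s (Num.bound B) (tau a x).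
    apply: eq_big_seq => x xF; have [mx sx] := FP x xF.
    rewrite tailcut_eq// (le_trans _ (ltW (archi_boundP B0)))//.
    rewrite -[leLHS](big_seq_fset1 +%R x (fun x => (tau a x - s)^-1 + (tau a x + 1))).
    apply: ler_sum_fset => [y|y|y]; rewrite ?inE.
    - by move=> /eqP ->; exact: term0.
    - exact: term0.
    - by move=> /eqP ->; rewrite xF.
  rewrite FE; apply: (linstat_tau_ge (M := (Num.bound B)%:R) a0 lf).
  - by move=> t; exact: tailcut_ge0.
  - by move=> t; exact: tailcut_eq0_far.
  - by move=> x /FP[].
move=> [n en]; rewrite /tail_event/=; set G := tailcut s n.
rewrite (linstat_tau (M := n%:R) a0 lf) in en; last by move=> t; exact: tailcut_eq0_far.
pose F := [fset x in tau_trace a n%:R mu | s < tau a x]%fset.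
have := @tailsum_ge R d beta r mu F; rewrite -/a => H.
apply: lt_le_trans (H _); last first.
  move=> x; rewrite !inE/= => /andP[/(tau_traceP _ a0 lf)[mx _]].
  by rewrite tau_gt ?ltW.
rewrite lte_fin (lt_le_trans en)// (bigID (fun x => s < tau a x))/=.
rewrite [X in _ + X]big1 ?addr0; last first.
  by move=> x; rewrite -leNgt => xs; exact: tailcut_eq0_near.
rewrite big_fset_condE; apply: ler_sum_fset_seq => x.
by rewrite !inE/= => /andP[_ sx]; exact: tailcut_le.
Qed.

Lemma measurable_tail_event r eta (X : O -> set 'rV[R]_d) : 0 < r -> point_process X ->
  measurable (X @^-1` tail_event beta r eta).
Proof.
move=> r0 [lf mX]; have s0 : 0 < r `^ a by exact: powR_gt0.
have -> : X @^-1` tail_event beta r eta =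
    \bigcup_n ((linstat (tailcut (r `^ a) n \o tau a) \o X) @^-1` `]eta, +oo[).
  apply/seteqP; split => w /=.
    by move=> /(tail_eventE eta r0 (lf w))[n en]; exists n => //=; rewrite in_itv/= en.
  move=> [n _ /=]; rewrite in_itv/= andbT => en.
  by apply/(tail_eventE eta r0 (lf w)); exists n.
apply: bigcupT_measurable => n.
rewrite -[X in measurable X]setTI; apply: mX => //.
apply: (Cc_tau (M := n%:R) _ a0); first exact: continuous_tailcut.
by move=> t; exact: tailcut_eq0_far.
Qed.

End TailEvent.

(** * Expectations *)

(* Unlike [ge0_le_integral], no measurability is required: the integral of a
   nonnegative function is a supremum over simple functions below it. *)
Lemma ge0_le_integral_sup (dO : measure_display) (O : measurableType dO) (R : realType)
  (mu : {measure set O -> \bar R}) (f g : O -> \bar R) :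
  (forall x, 0 <= f x)%E -> (forall x, f x <= g x)%E ->
  (\int[mu]_x f x <= \int[mu]_x g x)%E.
Proof.
move=> f0 fg; have g0 x : (0 <= g x)%E by exact: le_trans (f0 x) (fg x).
rewrite !ge0_integralTE//; apply: le_ereal_sup => _ [h hf <-].
by exists h => // x; exact: le_trans (hf x) (fg x).
Qed.

Section BoundedMeasurable.
Variables (R : realType) (dO : measure_display) (O : measurableType dO) (P : probability O R).
Implicit Types f g : O -> R.

Definition bounded_measurable f := measurable_fun setT f /\ exists M, forall w, `|f w| <= M.

Lemma bounded_measurable_integrable f : bounded_measurable f ->
  P.-integrable setT (EFin \o f).
Proof.
move=> [mf [M fM]]; apply: measurable_bounded_integrable => //.
  by rewrite (le_lt_trans (probability_le1 P measurableT))// ltry.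
exists M; split; first exact: num_real.
by move=> y My w _ /=; rewrite (le_trans (fM w))// ltW.
Qed.

Lemma bounded_measurable_fin f : bounded_measurable f ->
  (\int[P]_w (f w)%:E)%E = (\int[P]_w f w)%:E.
Proof.
move=> bf; rewrite /Rintegral fineK//.
exact: (integrable_fin_num measurableT (bounded_measurable_integrable bf)).
Qed.

Lemma bounded_measurable_add f g : bounded_measurable f -> bounded_measurable g ->
  bounded_measurable (fun w => f w + g w).
Proof.
move=> [mf [M fM]] [mg [N gN]]; split; first exact: measurable_funD.
by exists (M + N) => w; rewrite (le_trans (ler_normD _ _))// lerD.
Qed.

Lemma bounded_measurable_cst c : bounded_measurable (fun=> c).
Proof. by split; [exact: measurable_cst|exists `|c|]. Qed.

Lemma bounded_measurable_scale c f : bounded_measurable f -> bounded_measurable (fun w => c * f w).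
Proof.
move=> [mf [M fM]]; split; first by apply: measurable_funM => //; exact: measurable_cst.
by exists (`|c| * M) => w; rewrite normrM ler_wpM2l.
Qed.

Lemma bounded_measurable_indic A : measurable A -> bounded_measurable (\1_A).
Proof.
move=> mA; split; first exact: measurable_indic.
by exists 1 => w; rewrite indicE; case: (w \in A); rewrite ?normr1 ?normr0.
Qed.

Lemma Rintegral_add f g : bounded_measurable f -> bounded_measurable g ->
  (\int[P]_w (f w + g w) = \int[P]_w f w + \int[P]_w g w)%R.
Proof. by move=> bf bg; apply: RintegralD => //; exact: bounded_measurable_integrable. Qed.

Lemma Rintegral_scale c f : bounded_measurable f ->
  (\int[P]_w (c * f w) = c * \int[P]_w f w)%R.
Proof. by move=> bf; apply: RintegralZl => //; exact: bounded_measurable_integrable. Qed.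

Lemma Rintegral_const c : (\int[P]_w c = c)%R.
Proof. rewrite Rintegral_cst// -[RHS]mulr1; congr (_ * _).
by have := congr1 fine (probability_setT P). Qed.

Lemma Rintegral_indic A : measurable A -> (\int[P]_w \1_A w = fine (P A))%R.
Proof. by move=> mA; rewrite /Rintegral integral_indic// setIT. Qed.

Lemma unit_integral_fin (Pi : O -> R) : (forall w, 0 <= Pi w <= 1) ->
  (\int[P]_w (Pi w)%:E \is a fin_num)%E.
Proof.
move=> Pi01; have Pi0 w : 0 <= Pi w by have /andP[] := Pi01 w.
rewrite ge0_fin_numE; last by apply: integral_ge0 => w _; rewrite lee_fin.
apply: (@le_lt_trans _ _ (\int[P]_w (cst 1 w)%:E)%E).
  by apply: ge0_le_integral_sup => w; rewrite lee_fin//; have /andP[] := Pi01 w.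
by rewrite (bounded_measurable_fin (bounded_measurable_cst 1)) ltry.
Qed.

(** [Pi] stands for the coverage product and is not assumed measurable; its integral is compared by
    monotonicity with those of measurable functions on either side. *)
Lemma integral_sandwich (Pi f B : O -> R) :
  (forall w, 0 <= Pi w <= 1) -> bounded_measurable f -> bounded_measurable B ->
  (forall w, 0 <= B w) -> {ae P, forall w, `|Pi w - f w| <= B w} ->
  `|\int[P]_w Pi w - \int[P]_w f w| <= \int[P]_w B w.
Proof.
move=> Pi01 bf bB B0 [N [mN N0 subN]].
have Pi0 w : 0 <= Pi w by have /andP[] := Pi01 w.
have Pi1 w : Pi w <= 1 by have /andP[] := Pi01 w.
have fin := unit_integral_fin Pi01; have [mf [M fM]] := bf.
have bN := bounded_measurable_indic mN.
(* On the null set [N] the difference is at most [1 + M], so [B'] bounds it everywhere with the same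
   integral as [B]. *)
pose B' w := B w + (1 + M) * \1_N w.
have bB' : bounded_measurable B'.
  by apply: bounded_measurable_add => //; exact: bounded_measurable_scale.
have EB' : (\int[P]_w B' w = \int[P]_w B w)%R.
  rewrite Rintegral_add//; last exact: bounded_measurable_scale.
  by rewrite Rintegral_scale// Rintegral_indic// N0/= mulr0 addr0.
have PiB w : `|Pi w - f w| <= B' w.
  rewrite /B' indicE; have [wN|wN] := boolP (w \in N).
    rewrite mulr1 (le_trans (ler_normB _ _))// (ger0_norm (Pi0 w)).
    by have := fM w; have := Pi1 w; have := B0 w; lra.
  rewrite mulr0 addr0; apply: contrapT => H; move/negP: wN; apply.
  by apply/mem_set/subN.
have M0 : 0 <= M := le_trans (normr_ge0 _) (fM point).
have B'0 w : 0 <= B' w by rewrite /B' addr_ge0// mulr_ge0 ?indicE// addr_ge0.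
rewrite -EB' ler_norml; apply/andP; split.
- rewrite lerBrDr addrC.
  (* Monotonicity is available for nonnegative lower functions; the positive part still lies below
     [Pi] because [Pi] is nonnegative. *)
  have bm : bounded_measurable (fun w => Num.max 0 (f w + (-1) * B' w)).
    have [mg [K gK]] : bounded_measurable (fun w => f w + (-1) * B' w).
      by apply: bounded_measurable_add => //; exact: bounded_measurable_scale.
    split; first by apply: measurable_maxr => //; exact: measurable_cst.
    exists K => w; have := gK w; case: (leP 0 (f w + -1 * B' w)) => // _.
    by rewrite normr0 => /(le_trans (normr_ge0 _)).
  have -> : \int[P]_w f w - \int[P]_w B' w = \int[P]_w (f w + (-1) * B' w).
    rewrite Rintegral_add ?Rintegral_scale ?mulN1r//; exact: bounded_measurable_scale.
  have bg : bounded_measurable (fun w => f w + (-1) * B' w).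
    by apply: bounded_measurable_add => //; exact: bounded_measurable_scale.
  apply: (@le_trans _ _ (\int[P]_w Num.max 0 (f w + (-1) * B' w))%R).
    apply: le_Rintegral => //; try exact: bounded_measurable_integrable.
    by move=> w _; rewrite le_max lexx orbT.
  rewrite -lee_fin -bounded_measurable_fin// /Rintegral fineK//.
  apply: ge0_le_integral_sup => w; rewrite lee_fin; first by rewrite le_max lexx.
  by rewrite ge_max Pi0/=; have := PiB w; rewrite ler_norml => /andP[]; lra.
- rewrite lerBlDr addrC -Rintegral_add// -lee_fin /Rintegral fineK//.
  rewrite -/(Rintegral _ _ _) -bounded_measurable_fin; last exact: bounded_measurable_add.
  apply: ge0_le_integral_sup => w; rewrite lee_fin//.
  by have := PiB w; rewrite ler_norml => /andP[]; lra.
Qed.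

Lemma bounded_convergence0 (v : nat -> O -> R) :
  (forall n, bounded_measurable (v n)) -> (forall n w, `|v n w| <= 1) ->
  {ae P, forall w, exists N, forall n, (N <= n)%N -> v n w = 0} ->
  (\int[P]_w v n w)%R @[n --> \oo] --> 0.
Proof.
move=> bv v1 v0.
have [] := @dominated_convergence _ _ _ P setT measurableT (fun n => EFin \o v n) (cst 0%E) (cst 1%E).
- by move=> n; apply/measurable_EFinP; have [] := bv n.
- exact: measurable_cst.
- apply: filterS v0 => w [N vN] _; apply: cvg_near_cst.
  by exists N => // n /= Nn; rewrite vN.
- exact: (bounded_measurable_integrable (bounded_measurable_cst 1)).
- by apply: aeW => w n _ /=; rewrite lee_fin.
move=> _ _; rewrite integral0 => /fine_cvg; apply: cvg_trans.
by apply: near_eq_cvg; apply: nearW => n.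
Qed.

End BoundedMeasurable.

Lemma ltr_dist4 (R : realFieldType) (x x' y y' e : R) :
  `|x - y| <= e -> `|x' - y'| <= e -> `|y - y'| < e -> `|x - x'| < 4 * e.
Proof.
rewrite !ler_norml !ltr_norml => /andP[? ?] /andP[? ?] /andP[? ?].
by apply/andP; split; lra.
Qed.

(** * Vanishing of the defects on a fixed configuration *)

Section Defects.
Variables (R : realType) (d : nat) (beta : R).
Let a := d%:R * beta.
Hypothesis a0 : 0 < a.
Implicit Types (mu : set 'rV[R]_d).

Lemma tau_eq0 (x : 'rV[R]_d) : tau a x = 0 -> x = 0.
Proof.
move=> /powR_eq0_eq0 e0; apply/rowP => i; rewrite mxE; apply/eqP.
by rewrite -normr_le0 -e0 coord_le_eucl.
Qed.

(** Only the origin has [tau] equal to [0], and a configuration, being a set, contains it at most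
    once. By local finiteness all other points eventually lie beyond [2 * dl], so the smoothed count
    is at most [1]. *)
Lemma pair_defect_eventually0 mu : locally_finite mu ->
  exists N, forall n, (N <= n)%N -> pair_defect beta n.+1%:R^-1 mu = 0.
Proof.
move=> lf; pose D := tau_trace a 2 mu.
(* An index above [B] gives [2 * dl <= tau a x] for every nonzero point of [D]; the origin
   contributes [0], as the inverse of [0] is [0]. *)
pose B := \sum_(x <- D) 2 * (tau a x)^-1.
have term0 (x : 'rV[R]_d) : 0 <= 2 * (tau a x)^-1 by rewrite mulr_ge0// invr_ge0 tau_ge0.
have B0 : 0 <= B by apply: sumr_ge0.
exists (Num.bound B) => n Bn; rewrite /pair_defect -/a; apply: clamp0.
set dl := n.+1%:R^-1; have dl0 : 0 < dl by rewrite invr_gt0.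
have dl1 : dl <= 1 by rewrite invf_le1// ler1n.
rewrite subr_le0 (bumpstatE a0)//; last by rewrite ltrDl.
have H : \sum_(x <- [fset 0 : 'rV[R]_d]%fset) bump dl (dl + dl) (tau a x) <= 1.
  by rewrite big_seq_fset1 bump_le1.
apply: le_trans H; apply: ler_sum_fset => [x _|x _|x]; [exact: bump_ge0|exact: bump_ge0|].
move=> /(tau_traceP (dl + dl) a0 lf)[mx xdl]; rewrite inE => x0.
apply: bump0; first by rewrite ltrDl.
have tx : 0 < tau a x.
  by rewrite lt_def tau_ge0 andbT; apply: contra x0 => /eqP/tau_eq0 ->.
have xD : x \in D by apply/(tau_traceP 2 a0 lf); split => //; lra.
have xB : 2 * (tau a x)^-1 <= B.
  rewrite -[leLHS](big_seq_fset1 +%R x (fun x => 2 * (tau a x)^-1)).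
  by apply: ler_sum_fset => // y; rewrite inE => /eqP ->; rewrite xD.
have : 2 * (tau a x)^-1 <= n.+1%:R.
  rewrite (le_trans xB)// (le_trans (ltW (archi_boundP B0)))// ler_nat.
  exact: leq_trans Bn (leqnSn _).
rewrite ler_pdivrMr// => h.
have -> : dl + dl = 2 / n.+1%:R by rewrite mulr_natl mulr2n.
by rewrite ler_pdivrMr// mulrC.
Qed.

Lemma crowd_defect_eventually0 M mu :
  exists N, forall n, (N <= n)%N -> crowd_defect beta M n%:R mu = 0.
Proof.
exists (Num.bound (bumpstat a M (M + 1) mu)) => n Bn; apply: clamp0; rewrite subr_le0.
rewrite (le_trans (ltW (archi_boundP _)))//; first exact: bumpstat_ge0.
by rewrite ler_nat.
Qed.

Lemma void_defect_eventually0 mu : locally_finite mu -> mu !=set0 ->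
  exists N, forall n, (N <= n)%N -> void_defect beta n%:R mu = 0.
Proof.
move=> lf [x mx]; exists (Num.bound (tau a x)) => n Bn; apply: clamp0; rewrite subr_le0.
apply: (bumpstat_ge1 a0 _ lf mx); first by rewrite ltrDl.
by rewrite (le_trans (ltW (archi_boundP _))) ?tau_ge0// ler_nat.
Qed.

End Defects.

(** * Choice of parameters and passage to the limit *)

Section Convergence.
Variables (R : realType) (d : nat) (beta th : R).
Variables (dO : measure_display) (O : measurableType dO) (P : probability O R).
Let a := d%:R * beta.
Hypotheses (a0 : 0 < a) (th0 : 0 < th).
Local Notation vague_functional := (@vague_functional R d dO O).

Lemma vague_functional_defects t dl M K : 0 < dl ->
  [/\ vague_functional (void_defect beta t),
      vague_functional (pair_defect beta dl) &
      vague_functional (crowd_defect beta M K)].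
Proof.
have lt1 (x : R) : x < x + 1 by rewrite ltrDl.
move=> dl0; split; apply: vague_functional_clamp.
- apply: vague_functional_add; first exact: vague_functional_cst.
  by apply: vague_functional_opp; exact: vague_functional_bumpstat.
- apply: vague_functional_add; last exact: vague_functional_cst.
  by apply: vague_functional_bumpstat; rewrite // ltrDl.
- apply: vague_functional_add; last exact: vague_functional_cst.
  exact: vague_functional_bumpstat.
Qed.

Lemma vague_bounded_measurable (X : O -> set 'rV[R]_d) f M : point_process X ->
  vague_functional f -> (forall mu, `|f mu| <= M) -> bounded_measurable (fun w => f (X w)).
Proof. by move=> pX [_ mf] fM; split; [exact: mf|exists M]. Qed.

Lemma norm_clamp (x : R) : `|clamp x| <= 1.
Proof. by rewrite ger0_norm ?clamp_ge0// clamp_le1. Qed.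

Lemma p_c_fin (X : O -> set 'rV[R]_d) : p_c P th beta X \is a fin_num.
Proof. by apply: unit_integral_fin => w; exact: cov_product_bounds (ltW th0) _. Qed.

Lemma expected_gridapprox (X : O -> set 'rV[R]_d) t dl M K h r eta n :
  point_process X -> {ae P, forall w, X w !=set0} ->
  0 < dl -> 0 < h -> 0 < r -> 0 <= t ->
  t + 1 <= M -> r `^ a <= M -> t + 1 <= n%:R * h -> 0 <= K -> 0 <= eta ->
  `|fine (p_c P th beta X) - \int[P]_w gridapprox a th dl M h n.+1 (X w)| <=
  (th * (t + 1) * eta + th / dl * h * (1 + (1 + th) * (K + 1))) +
  (1 + th) * (\int[P]_w void_defect beta t (X w) + \int[P]_w crowd_defect beta M K (X w) +
    \int[P]_w pair_defect beta dl (X w) + fine (P (X @^-1` tail_event beta r eta))).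
Proof.
move=> pX neX dl0 h0 r0 t0 tM rM tn K0 eta0; set err := th * _ * eta + _.
have [vv vp vc] := vague_functional_defects t M K dl0.
have bv := vague_bounded_measurable pX vv (fun mu => norm_clamp _).
have bp := vague_bounded_measurable pX vp (fun mu => norm_clamp _).
have bc := vague_bounded_measurable pX vc (fun mu => norm_clamp _).
have bg : bounded_measurable (fun w => gridapprox a th dl M h n.+1 (X w)).
  apply: (vague_bounded_measurable (M := n.+1%:R * (1 + th)) pX).
    exact: (vague_functional_gridapprox _ a0 _ M (ltW th0) dl0 h0).
  by move=> mu; exact: norm_gridapprox (ltW th0) dl0 h0 _ _.
have mT := measurable_tail_event a0 eta r0 pX.
have bT := bounded_measurable_indic R mT.
have b2 := bounded_measurable_add bv bc.
have b3 := bounded_measurable_add b2 bp.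
have b4 := bounded_measurable_add b3 bT.
have b5 := bounded_measurable_scale (1 + th) b4.
have b6 := bounded_measurable_add (bounded_measurable_cst O err) b5.
have thp : 0 <= 1 + th by rewrite addr_ge0// ltW.
have -> : err + (1 + th) * (\int[P]_w void_defect beta t (X w) +
    \int[P]_w crowd_defect beta M K (X w) + \int[P]_w pair_defect beta dl (X w) +
    fine (P (X @^-1` tail_event beta r eta))) =
  \int[P]_w (err + (1 + th) * (void_defect beta t (X w) + crowd_defect beta M K (X w) +
    pair_defect beta dl (X w) + \1_(X @^-1` tail_event beta r eta) w)).
  rewrite (Rintegral_add P (bounded_measurable_cst O err) b5) Rintegral_const.
  rewrite (Rintegral_scale P (1 + th) b4) (Rintegral_add P b3 bT) (Rintegral_add P b2 bp).
  by rewrite (Rintegral_add P bv bc) Rintegral_indic.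
have err0 : 0 <= err.
  rewrite /err addr_ge0 ?mulr_ge0 ?invr_ge0 ?(ltW th0) ?(ltW dl0) ?(ltW h0) ?addr_ge0//.
  by rewrite mulr_ge0// addr_ge0.
apply: integral_sandwich => //.
- by move=> w; exact: cov_product_bounds (ltW th0) _.
- by move=> w; rewrite addr_ge0// mulr_ge0// !addr_ge0 ?clamp_ge0// indicE.
apply: filterS neX => w neX.
have -> : \1_(X @^-1` tail_event beta r eta) w = \1_(tail_event beta r eta) (X w) :> R.
  by rewrite !indicE.
exact: (gridapprox_estimate a0 (ltW th0) (pX.1 w) neX dl0 h0 (ltW r0) t0 tM rM tn K0 eta0).
Qed.

Variables (Xi : O -> set 'rV[R]_d) (Xis : R -> O -> set 'rV[R]_d).
Hypotheses (pXi : point_process Xi) (pXis : forall s, 0 < s -> point_process (Xis s)).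
Hypotheses (neXi : {ae P, forall w, Xi w !=set0})
  (neXis : forall s, 0 < s -> {ae P, forall w, Xis s w !=set0}).
Hypothesis conv : forall f : set 'rV[R]_d -> R, vague_bounded_continuous f ->
     (fun s => \int[P]_w (f (Xis s w))%:E)%E @ +oo
       --> (\int[P]_w (f (Xi w))%:E)%E.
Hypothesis tail : forall eps : R, 0 < eps ->
     (fun r : R => ereal_sup
        [set P [set w | (eps%:E < tailsum beta r (X w))%E] |
          X in [set X | X = Xi \/ exists2 s, 0 < s & X = Xis s]])
       @ +oo --> 0%E.

Lemma cvg_expectation f M : vague_functional f -> (forall mu, `|f mu| <= M) ->
  \int[P]_w f (Xis s w) @[s --> +oo] --> \int[P]_w f (Xi w).
Proof.
move=> vf fM; have := conv (vague_functional_bounded vf fM).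
rewrite (bounded_measurable_fin P (vague_bounded_measurable pXi vf fM)).
exact: fine_cvg.
Qed.

(** Under [Xi] the expectations tend to [0] by bounded convergence. Fixing one [n] and applying
    convergence in distribution to the single functional [v n] transfers the bound to [Xis s] for
    large [s]. *)
Lemma expectation_small (v : nat -> set 'rV[R]_d -> R) e :
  (forall n, vague_functional (v n)) -> (forall n mu, `|v n mu| <= 1) ->
  (forall mu, locally_finite mu -> mu !=set0 ->
    exists N, forall n, (N <= n)%N -> v n mu = 0) -> 0 < e ->
  exists n, \int[P]_w v n (Xi w) < e /\ \forall s \near +oo, \int[P]_w v n (Xis s w) < e.
Proof.
move=> vv v1 v0 e0.
have cv : (\int[P]_w v n (Xi w))%R @[n --> \oo] --> 0.
  apply: bounded_convergence0 => [n|n w|].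
  - exact: vague_bounded_measurable (vv n) (v1 n).
  - exact: v1.
  - by apply: filterS neXi => w; exact: v0 (pXi.1 w).
have [n _ /(_ n (leqnn n)) vn] := cvgr_lt _ cv _ e0.
exists n; split => //.
exact: (cvgr_lt _ (cvg_expectation (vv n) (v1 n)) _ vn).
Qed.

Lemma tail_small eta q : 0 < eta -> 0 < q -> exists r, 0 < r /\
  forall X, X = Xi \/ (exists2 s, 0 < s & X = Xis s) ->
    fine (P (X @^-1` tail_event beta r eta)) < q.
Proof.
move=> eta0 q0; have /fine_cvgP[fin /cvgrPdist_lt/(_ q q0) small] := tail eta0.
(* This makes [r] positive, as [measurable_tail_event] requires. *)
have r1 : \forall r \near +oo, (1 : R) <= r by apply: nbhs_pinfty_ge; exact: num_real.
have [r [[rfin rsmall] r1']] := @filter_ex _ _ _ _ (filterI (filterI fin small) r1).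
have r0 : 0 < r by rewrite (lt_le_trans ltr01).
exists r; split => // X XF; set A := X @^-1` _.
have pX : point_process X by case: XF => [->//|[s s0 ->]]; exact: pXis.
have mA : measurable A by exact: measurable_tail_event.
set F := ereal_sup _ in rfin; have PF : (P A <= F)%E.
  by apply: ereal_sup_ubound; exists X.
apply: (@le_lt_trans _ _ (fine F)).
  by apply: fine_le => //; rewrite fin_num_measure.
by move: rsmall; rewrite /= sub0r normrN => /(le_lt_trans (ler_norm _)).
Qed.

(** The parameters are chosen in an order without circularity: [t] and [dl], then [eta] from [t],
    [r] from [eta], [M] from [t] and [r], [K] from [M], [h] from [dl] and [K], and finally [n]. *)
Lemma cvg_p_c : p_c P th beta (Xis s) @[s --> +oo] --> p_c P th beta Xi.
Proof.
rewrite -(fineK (p_c_fin Xi)); apply/fine_cvgP; split.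
  by apply: nearW => s; exact: p_c_fin.
apply/cvgrPdist_lt => e0 e0_gt0.
(* Three gaps of size at most [e] arise: from either coverage probability to its grid functional,
   and between the two expectations of that functional. *)
pose e := e0 / 4; have e_gt0 : 0 < e by rewrite /e; lra.
have thp : 0 < 1 + th by rewrite addr_gt0.
(* Four bad events of expected weight [q], multiplied by [1 + th], cost [e / 2]; [eta] and [h] below
   are set to cost [e / 4] each. *)
pose q := e / (8 * (1 + th)); have q0 : 0 < q by rewrite divr_gt0// mulr_gt0.
have [n1 [vXi vXis]] := expectation_small (v := fun n => void_defect beta n%:R)
  (fun n => let: And3 v _ _ := vague_functional_defects n%:R 0 0 ltr01 in v)
  (fun n mu => norm_clamp _) (void_defect_eventually0 a0) q0.
have inv0 n : 0 < n.+1%:R^-1 :> R by rewrite invr_gt0.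
have [n2 [pXi' pXis']] := expectation_small (v := fun n => pair_defect beta n.+1%:R^-1)
  (fun n => let: And3 _ v _ := vague_functional_defects 0 0 0 (inv0 n) in v)
  (fun n mu => norm_clamp _) (fun mu lf _ => pair_defect_eventually0 a0 lf) q0.
set t := n1%:R in vXi vXis; set dl := n2.+1%:R^-1 in pXi' pXis'.
have t0 : 0 <= t by exact: ler0n.
have dl0 : 0 < dl by exact: inv0.
pose eta := e / (4 * (th * (t + 1))).
have t1 : 0 < t + 1 by lra.
have eta0 : 0 < eta by rewrite divr_gt0// !mulr_gt0.
have [r [r0 rtail]] := tail_small eta0 q0.
(* The first bound keeps the nearest point inside the cutoff; the second places every point with
   [tau] beyond [M] in the tail sum of radius [r]. *)
pose M := Num.max (t + 1) (r `^ a).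
have [n3 [cXi cXis]] := expectation_small (v := fun n => crowd_defect beta M n%:R)
  (fun n => let: And3 _ _ v := vague_functional_defects 0 M n%:R ltr01 in v)
  (fun n mu => norm_clamp _) (fun mu _ _ => crowd_defect_eventually0 _ M mu) q0.
set K := n3%:R in cXi cXis; have K0 : 0 <= K by exact: ler0n.
pose D := th / dl * (1 + (1 + th) * (K + 1)).
have D0 : 0 < D.
  by rewrite mulr_gt0 ?divr_gt0// addr_gt0// mulr_gt0//; lra.
pose h := e / (4 * D); have h0 : 0 < h by rewrite divr_gt0// mulr_gt0.
pose n := Num.bound ((t + 1) / h).
have tn : t + 1 <= n%:R * h.
  by rewrite -ler_pdivrMr// ltW// archi_boundP// divr_ge0// ltW.
have tM : t + 1 <= M by rewrite le_max lexx.
have rM : r `^ a <= M by rewrite le_max lexx orbT.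
have err : th * (t + 1) * eta + th / dl * h * (1 + (1 + th) * (K + 1)) = e / 2.
  have -> : th / dl * h * (1 + (1 + th) * (K + 1)) = D * h by rewrite /D; ring.
  by rewrite /eta /h; field; rewrite !gt_eqF.
have qE : (1 + th) * (q + q + q + q) = e / 2 by rewrite /q; field; rewrite gt_eqF.
have close (X : O -> set 'rV[R]_d) : X = Xi \/ (exists2 s, 0 < s & X = Xis s) ->
    \int[P]_w void_defect beta t (X w) < q -> \int[P]_w crowd_defect beta M K (X w) < q ->
    \int[P]_w pair_defect beta dl (X w) < q ->
    `|fine (p_c P th beta X) - \int[P]_w gridapprox a th dl M h n.+1 (X w)| <= e.
  move=> XF h1 h2 h3; have h4 := rtail X XF.
  have pX : point_process X by case: XF => [->//|[s s0 ->]]; exact: pXis.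
  have neX : {ae P, forall w, X w !=set0} by case: XF => [->//|[s s0 ->]]; exact: neXis.
  apply: (le_trans (expected_gridapprox pX neX dl0 h0 r0 t0 tM rM tn K0 (ltW eta0))).
  rewrite err [leRHS](_ : e = e / 2 + e / 2); last by lra.
  by rewrite lerD2l -qE ler_wpM2l ?(ltW thp)// !lerD// ltW.
have cXi0 := close Xi (or_introl erefl) vXi cXi pXi'.
have vg := vague_functional_gridapprox d a0 O M (ltW th0) dl0 h0 n.+1.
have cg := cvg_expectation vg (norm_gridapprox a M (ltW th0) dl0 h0 n.+1).
have /cvgrPdist_lt/(_ e e_gt0) cg' := cg.
have s_gt0 : \forall s \near +oo, (0 : R) < s by apply: nbhs_pinfty_gt; exact: num_real.
near=> s.
have s0 : 0 < s by near: s.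
have cs : `|fine (p_c P th beta (Xis s)) - \int[P]_w gridapprox a th dl M h n.+1 (Xis s w)| <= e.
  by apply: close; [right; exists s|near: s..].
have gs : `|\int[P]_w gridapprox a th dl M h n.+1 (Xi w) -
   \int[P]_w gridapprox a th dl M h n.+1 (Xis s w)| < e by near: s.
have -> : e0 = 4 * e by rewrite /e; field.
exact: ltr_dist4 cXi0 cs gs.
Unshelve. all: by end_near. Qed.

End Convergence.

Theorem mainTheorem3 (R : realType) (d : nat) (beta theta : R)
  (dO : measure_display) (O : measurableType dO) (P : probability O R)
  (Xi : O -> set 'rV[R]_d) (Xis : R -> O -> set 'rV[R]_d) :
  (2 <= d)%N -> 1 < beta -> 0 < theta ->
  point_process Xi -> (forall s, 0 < s -> point_process (Xis s)) ->
  {ae P, forall w, Xi w !=set0} ->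
  (forall s, 0 < s -> {ae P, forall w, Xis s w !=set0}) ->
  (* convergence in distribution for the vague topology *)
  (forall f : set 'rV[R]_d -> R, vague_bounded_continuous f ->
     (fun s => \int[P]_w (f (Xis s w))%:E)%E @ +oo
       --> (\int[P]_w (f (Xi w))%:E)%E) ->
  (* uniform tail condition over the family {Xi} u {Xis s | s > 0} *)
  (forall eps : R, 0 < eps ->
     (fun r : R => ereal_sup
        [set P [set w | (eps%:E < tailsum beta r (X w))%E] |
          X in [set X | X = Xi \/ exists2 s, 0 < s & X = Xis s]])
       @ +oo --> 0%E) ->
  (fun s => p_c P theta beta (Xis s)) @ +oo --> p_c P theta beta Xi.
Proof.
move=> d2 b1 th0 pXi pXis neXi neXis conv tail.
have a0 : 0 < d%:R * beta.
  by rewrite mulr_gt0 ?(lt_trans ltr01 b1)// ltr0n (leq_trans _ d2).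
exact: (cvg_p_c a0 th0 pXi pXis neXi neXis conv tail).
Qed.
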